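(* Assume that Conditions 1, 2, 3, 4 and 5 listed in the context hold. Then, for predetermined working correlation matrices $\mathbf{W}$ and a nonrandom penalty vector $\boldsymbol{\lambda}$, as $n\to\infty$, $$\operatorname{LsoCV}^*(\mathbf{W},\boldsymbol{\lambda})-L(\mathbf{W},\boldsymbol{\lambda})-\frac1n\boldsymbol{\varepsilon}^T\boldsymbol{\varepsilon}=o_p\bigl(L(\mathbf{W},\boldsymbol{\lambda})\bigr).$$
   Context: **Model.** There are $n$ independent subjects; subject $i$ has $n_i$ observations, $N=\sum_{i=1}^n n_i$ (the $n_i$ need not be bounded). $\mathbf{y}_i\in\mathbb{R}^{n_i}$ is the response vector of subject $i$. Given the covariates (all expectations, variances and probabilities are conditional on the covariates, which are treated as fixed), $E(\mathbf{y}_i)=\boldsymbol{\mu}_i$ and $\operatorname{Cov}(\mathbf{y}_i)=\boldsymbol{\Sigma}_i$ (an $n_i\times n_i$ positive definite matrix). The mean has components $\mu_{ij}=\mathbf{x}_{ij0}\boldsymbol{\beta}_0+\sum_{k=1}^m f_k(\mathbf{x}_{ijk})$ with unknown vector $\boldsymbol\beta_0$ and unknown smooth functions $f_k$. Put $\mathbf{Y}=(\mathbf{y}_1^T,\dots,\mathbf{y}_n^T)^T$, $\boldsymbol{\mu}=(\boldsymbol{\mu}_1^T,\dots,\boldsymbol{\mu}_n^T)^T$, $\boldsymbol{\varepsilon}=\mathbf{Y}-\boldsymbol{\mu}$ with subvectors $\boldsymbol{\varepsilon}_i=\mathbf{y}_i-\boldsymbol{\mu}_i$, $\boldsymbol{\Sigma}=\operatorname{diag}\{\boldsymbol{\Sigma}_1,\dots,\boldsymbol{\Sigma}_n\}$.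 **Estimator.** $\mathbf{X}_i$ is an $n_i\times p$ design matrix (obtained by basis expansion of the $f_k$; $\boldsymbol{\mu}_i$ is approximated by $\mathbf{X}_i\boldsymbol{\beta}$ but need not lie in its range), $\mathbf{X}=(\mathbf{X}_1^T,\dots,\mathbf{X}_n^T)^T$; $\mathbf{W}_i$ is a symmetric positive definite $n_i\times n_i$ working correlation matrix, possibly misspecified (not related to $\boldsymbol\Sigma_i$), $\mathbf{W}=\operatorname{diag}\{\mathbf{W}_1,\dots,\mathbf{W}_n\}$; ''predetermined'' means that $\mathbf{W}$ is determined by observation times and/or covariates (so it is nonrandom given the covariates). $\mathbf{S}_1,\dots,\mathbf{S}_m$ are symmetric positive semi-definite $p\times p$ penalty matrices and $\boldsymbol{\lambda}=(\lambda_1,\dots,\lambda_m)$, $\lambda_k\ge0$. The estimate of $\boldsymbol\mu$ is $\mathbf{X}\hat{\boldsymbol\beta}=\mathbf{A}\mathbf{Y}$, where $\hat{\boldsymbol\beta}$ minimizes $\sum_{i}(\mathbf{y}_i-\mathbf{X}_i\boldsymbol\beta)^T\mathbf{W}_i^{-1}(\mathbf{y}_i-\mathbf{X}_i\boldsymbol\beta)+\sum_k\lambda_k\boldsymbol\beta^T\mathbf{S}_k\boldsymbol\beta$ and $$\mathbf{A}=\mathbf{A}(\mathbf{W},\boldsymbol\lambda)=\mathbf{X}\Bigl(\mathbf{X}^T\mathbf{W}^{-1}\mathbf{X}+\sum_{k=1}^m\lambda_k\mathbf{S}_k\Bigr)^{-1}\mathbf{X}^T\mathbf{W}^{-1},$$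 the inverted matrix being assumed invertible. All quantities ($n_i$, $p$, $\mathbf X$, $\mathbf W$, $\boldsymbol\lambda$, ...) may depend on $n$. **Notation.** $\tilde{\mathbf{A}}=\mathbf{W}^{-1/2}\mathbf{A}\mathbf{W}^{1/2}$ (symmetric); $\mathbf{A}_{ii}$ and $\mathbf{C}_{ii}$ are the $i$th $n_i\times n_i$ diagonal blocks (subject $i$) of $\mathbf{A}$ and $\tilde{\mathbf{A}}^2$; $\lambda_{\max}(\cdot)$ is the largest eigenvalue; $\xi(\boldsymbol\Sigma,\mathbf{W})=\lambda_{\max}(\boldsymbol\Sigma\mathbf{W}^{-1})\lambda_{\max}(\mathbf{W})$; $\mathbf{e}_i=\boldsymbol\Sigma_i^{-1/2}\boldsymbol\varepsilon_i$. **Criterion, loss and risk.** $$\operatorname{LsoCV}^*(\mathbf{W},\boldsymbol\lambda)=\frac1n\mathbf{Y}^T(\mathbf{I}-\mathbf{A})^T(\mathbf{I}-\mathbf{A})\mathbf{Y}+\frac2n\sum_{i=1}^n\hat{\mathbf{e}}_i^T\mathbf{A}_{ii}\hat{\mathbf{e}}_i,$$ where $\hat{\mathbf{e}}_i\in\mathbb{R}^{n_i}$ is the part of $\hat{\mathbf{e}}=(\mathbf{I}-\mathbf{A})\mathbf{Y}$ corresponding to subject $i$; $$L(\mathbf{W},\boldsymbol\lambda)=\frac1n(\mathbf{A}\mathbf{Y}-\boldsymbol\mu)^T(\mathbf{A}\mathbf{Y}-\boldsymbol\mu),\qquad R(\mathbf{W},\boldsymbol\lambda)=E\{L(\mathbf{W},\boldsymbol\lambda)\}=\frac1n\boldsymbol\mu^T(\mathbf{I}-\mathbf{A})^T(\mathbf{I}-\mathbf{A})\boldsymbol\mu+\frac1n\operatorname{tr}(\mathbf{A}^T\mathbf{A}\boldsymbol\Sigma).$$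 **Conditions** (asymptotics as $n\to\infty$). - Condition 1: for some constant $K>0$, $E\{(\mathbf{u}_i^T\mathbf{e}_i)^4\}\le K$ for all $i=1,\dots,n$ and all $\mathbf{u}_i\in\mathbb{R}^{n_i}$ with $\mathbf{u}_i^T\mathbf{u}_i=1$. - Condition 2: (i) $\max_{1\le i\le n}\operatorname{tr}(\mathbf{A}_{ii})=O(\operatorname{tr}(\mathbf{A})/n)=o(1)$ (in particular $\operatorname{tr}(\mathbf A)/n\to0$); (ii) $\max_{1\le i\le n}\operatorname{tr}(\mathbf{C}_{ii})=o(1)$. - Condition 3: $\xi(\boldsymbol\Sigma,\mathbf{W})/n=o(R(\mathbf{W},\boldsymbol\lambda))$. - Condition 4: $\xi(\boldsymbol\Sigma,\mathbf{W})\{n^{-1}\operatorname{tr}(\mathbf{A})\}^2/\{n^{-1}\operatorname{tr}(\mathbf{A}^T\mathbf{A}\boldsymbol\Sigma)\}=o(1)$. - Condition 5: $\lambda_{\max}(\mathbf{W})\lambda_{\max}(\mathbf{W}^{-1})\,n^{-2}\operatorname{tr}(\mathbf{A})^2=o(1)$. *)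

(* Defs.v *)
From HB Require Import structures.
From mathcomp Require Import all_boot all_order all_algebra.
From mathcomp Require Import all_classical all_reals all_analysis.

Set Implicit Arguments.
Unset Strict Implicit.
Unset Printing Implicit Defensive.

Import Order.TTheory GRing.Theory Num.Theory.
Import numFieldNormedType.Exports.

Local Open Scope classical_set_scope.
Local Open Scope ring_scope.

Section Matrices.
Context {R : realType}.

Definition sqnorm k (v : 'cV[R]_k) : R := (v^T *m v) 0 0.

Definition posdef k (A : 'M[R]_k) : Prop :=
  A^T = A /\ forall v : 'cV[R]_k, v != 0 -> 0 < (v^T *m A *m v) 0 0.

Definition possemidef k (A : 'M[R]_k) : Prop :=
  A^T = A /\ forall v : 'cV[R]_k, 0 <= (v^T *m A *m v) 0 0.

(* The symmetric positive semi-definite square root: it exists and is unique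
   when A is symmetric positive semi-definite; 0 is a dummy value otherwise. *)
Definition sqrtmx k (A : 'M[R]_k) : 'M[R]_k :=
  xget 0 [set B : 'M[R]_k | possemidef B /\ B *m B = A].

(* Only real eigenvalues are considered: this is the largest eigenvalue for a
   nonempty matrix all of whose eigenvalues are real, such as a product of two
   symmetric positive definite matrices. *)
Definition lambda_max k (A : 'M[R]_k) : R := sup [set a : R | eigenvalue A a].

End Matrices.

(* Mutual independence of the sigma-algebras generated by the random vectors
   y i = (y i j)_j, for i < n. *)
Definition independent_vectors (R : realType) (d : measure_display)
    (T : measurableType d) (P : probability T R) (n : nat) (k : 'I_n -> nat)
    (y : forall i : 'I_n, 'I_(k i) -> {RV P >-> R}) : Prop :=
  forall (J : {set 'I_n}) (E : 'I_n -> set T),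
    (forall i, g_sigma_preimage (fun j => y i j : T -> R) (E i)) ->
    P (\bigcap_(i in [set` J]) E i) = (\prod_(i in J) P (E i))%E.

(* The data for n subjects. The covariates are fixed, so prob, and with it all
   means, covariances and probabilities, is the law given the covariates, and
   the design, working correlation and penalty fields are nonrandom. *)
Record model (R : realType) (n : nat) := Model {
  disp : measure_display;
  sample : measurableType disp;
  prob : probability sample R;
  nobs : 'I_n -> nat;
  nobs_gt0 : forall i, (0 < nobs i)%N;
  response : forall i : 'I_n, 'I_(nobs i) -> {RV prob >-> R};
  response_indep : independent_vectors response;
  (* The mean is x_0 beta_0 + f_1(x_1) + ... + f_m(x_m), with m = nfun, and
     is not assumed to lie in the range of the design matrix. No regularity
     is required of the f_k. *)
  nlin : nat;
  nfun : nat;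
  covdim : 'I_nfun -> nat;
  lin_covariate : forall i : 'I_n, 'I_(nobs i) -> 'rV[R]_nlin;
  beta0 : 'cV[R]_nlin;
  covariate : forall i : 'I_n, 'I_(nobs i) -> forall k : 'I_nfun,
    'rV[R]_(covdim k);
  smooth_fun : forall k : 'I_nfun, 'rV[R]_(covdim k) -> R;
  mean := fun i : 'I_n => \col_(j < nobs i)
    ((lin_covariate j *m beta0) 0 0
      + \sum_(k < nfun) smooth_fun (covariate j k)) : 'cV[R]_(nobs i);
  response_mean : forall (i : 'I_n) (j : 'I_(nobs i)),
    ('E_prob[response j] = (mean i j 0)%:E)%E;
  cov : forall i : 'I_n, 'M[R]_(nobs i);
  cov_posdef : forall i, posdef (cov i);
  response_cov : forall (i : 'I_n) (j l : 'I_(nobs i)),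
    covariance prob (response j) (response l) = (cov i j l)%:E;
  ncoef : nat;
  design_block : forall i : 'I_n, 'M[R]_(nobs i, ncoef);
  wcor_block : forall i : 'I_n, 'M[R]_(nobs i);
  wcor_posdef : forall i, posdef (wcor_block i);
  penalty : 'I_nfun -> 'M[R]_ncoef;
  penalty_psd : forall k, possemidef (penalty k);
  lam : 'I_nfun -> R;
  lam_ge0 : forall k, 0 <= lam k;
  design := \mxcol_(i < n) design_block i : 'M[R]_(\sum_i nobs i, ncoef);
  wcor := \mxdiag_(i < n) wcor_block i : 'M[R]_(\sum_i nobs i);
  normal_mx := design^T *m invmx wcor *m design
               + \sum_(k < nfun) lam k *: penalty k : 'M[R]_ncoef;
  normal_mx_unit : normal_mx \in unitmx
}.

Section Estimator.
Context {R : realType} {n : nat} (M : model R n).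

Definition resp_block (i : 'I_n) (w : sample M) : 'cV[R]_(nobs M i) :=
  \col_j response j w.
Definition resp (w : sample M) : 'cV[R]_(\sum_i nobs M i) :=
  \mxcol_(i < n) resp_block i w.
Definition mu : 'cV[R]_(\sum_i nobs M i) := \mxcol_(i < n) mean M i.
Definition Sigma : 'M[R]_(\sum_i nobs M i) := \mxdiag_(i < n) cov M i.
Definition noise (w : sample M) : 'cV[R]_(\sum_i nobs M i) := resp w - mu.

Definition std_noise (i : 'I_n) (w : sample M) : 'cV[R]_(nobs M i) :=
  invmx (sqrtmx (cov M i)) *m (resp_block i w - mean M i).

(* A = A(W, lambda): the fitted mean A Y is X betahat, where betahat minimizes
   the weighted and penalized least squares criterion. *)
Definition hat : 'M[R]_(\sum_i nobs M i) :=
  design M *m invmx (normal_mx M) *m (design M)^T *m invmx (wcor M).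

(* W^{-1/2} A W^{1/2} *)
Definition hat_sym : 'M[R]_(\sum_i nobs M i) :=
  invmx (sqrtmx (wcor M)) *m hat *m sqrtmx (wcor M).

Definition hat_block (i : 'I_n) : 'M[R]_(nobs M i) := submxblock hat i i.
Definition hat_sym2_block (i : 'I_n) : 'M[R]_(nobs M i) :=
  submxblock (hat_sym *m hat_sym) i i.

Definition xi : R :=
  lambda_max (Sigma *m invmx (wcor M)) * lambda_max (wcor M).

Definition residual (w : sample M) : 'cV[R]_(\sum_i nobs M i) :=
  (1%:M - hat) *m resp w.

Definition LsoCV (w : sample M) : R :=
  n%:R^-1 * sqnorm (residual w)
  + 2 / n%:R * \sum_(i < n) ((submxcol (residual w) i)^T *m hat_block i
                               *m submxcol (residual w) i) 0 0.

Definition loss (w : sample M) : R := n%:R^-1 * sqnorm (hat *m resp w - mu).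

Definition risk : R := fine ('E_(prob M)[loss])%E.

End Estimator.

Arguments noise {R n} M w.
Arguments LsoCV {R n} M w.
Arguments loss {R n} M w.

Section Conditions.
Context {R : realType} (M : forall n, model R n).

Definition condition1 : Prop := exists2 K : R, 0 < K &
  forall n (i : 'I_n) (u : 'cV[R]_(nobs (M n) i)), sqnorm u = 1 ->
    ('E_(prob (M n))[fun w => ((u^T *m std_noise i w) 0 0 ^+ 4)%R] <= K%:E)%E.

(* The default value 0 of the two maxima is harmless, as the traces are
   nonnegative. *)
Definition condition2 : Prop :=
  [/\ (fun n => \big[Num.max/0]_(i < n) \tr (hat_block (M n) i))
        =O_\oo (fun n => \tr (hat (M n)) / n%:R),
      (\tr (hat (M n)) / n%:R) @[n --> \oo] --> (0 : R) &
      (\big[Num.max/0]_(i < n) \tr (hat_sym2_block (M n) i)) @[n --> \oo]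
        --> (0 : R)].

Definition condition3 : Prop :=
  (fun n => xi (M n) / n%:R) =o_\oo (fun n => risk (M n)).

Definition condition4 : Prop :=
  (xi (M n) * (n%:R^-1 * \tr (hat (M n))) ^+ 2
    / (n%:R^-1 * \tr ((hat (M n))^T *m hat (M n) *m Sigma (M n))))
    @[n --> \oo] --> (0 : R).

Definition condition5 : Prop :=
  (lambda_max (wcor (M n)) * lambda_max (invmx (wcor (M n)))
    * (n%:R ^- 2 * \tr (hat (M n)) ^+ 2)) @[n --> \oo] --> (0 : R).

(* Z_n = o_p(V_n), written without the quotient Z_n / V_n: V_n may vanish. *)
Definition littleo_p (Z V : forall n, sample (M n) -> R) : Prop :=
  forall eps : R, 0 < eps ->
    prob (M n) [set w | eps * `|V n w| < `|Z n w|] @[n --> \oo] --> 0%E.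

End Conditions.

Arguments littleo_p {R} M Z V.

(* Main.v *)
(* Put e = Y - mu, b = (I - A) mu, r = A Y - mu = A e - b, and let D be the
   block diagonal matrix of the A_ii.  Then n L = |r|^2 and
     (n / 2) (LsoCV* - L - |e|^2 / n)
       = ((I + D) b)^T e - q((I + D) A) - e^T D^2 e - r^T D e + r^T D r,
   where q(B) is the quadratic form of B in e without its diagonal blocks.
   From Sigma <= lambda_max(Sigma W^-1) W and A W A^T <= W one gets
   A Sigma A^T <= xi I; with the independence of the subjects this bounds the
   second moments of the first two terms, and of |r|^2 - E |r|^2, by a constant
   times xi n R, which is o(n^2 R^2) by Condition 3; the diagonal blocks of
   e^T A^T A e give a centred sum over the subjects, whose variance is
   controlled by Conditions 1 and 2 (ii).  The mean of a majorant of
   |e^T D^2 e|, and that of |D e|^2, are at most xi sum_i tr(A_ii)^2, which is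
   o(n R) by Conditions 2 (i) and 4.
   Condition 5 makes the operator norm of D small, so that the two terms
   involving r are absorbed into |r|^2 by AM-GM. *)

Require Import Defs.
From HB Require Import structures.
From mathcomp Require Import all_boot all_order all_algebra.
From mathcomp Require Import all_classical all_reals all_analysis.
From mathcomp Require Import ring lra measurable_realfun.

Set Implicit Arguments.
Unset Strict Implicit.
Unset Printing Implicit Defensive.

Import Order.TTheory GRing.Theory Num.Theory.
Import numFieldNormedType.Exports.

Local Open Scope ring_scope.

(** * Positive semi-definite matrices *)

Section BilinearForms.
Context {R : realType}.
Implicit Types k : nat.

(** The correction term of the criterion is there to remove the diagonal blocks of [A] from the
    quadratic form of the noise. What is left of that form pairs different subjects only, so its
    second moment involves covariances alone. Fourth moments, hence Condition 1, matter only for the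
    squared length of the fit within one subject; since the number of observations per subject is
    unbounded, they are used along arbitrary directions and never summed coordinate by coordinate.
    Neither [A] nor its block diagonal [D] is symmetric. The bounds therefore pass through the
    symmetric matrices [H = A W] and [D W D^T], compared with [W] in the Loewner order; [W^{1/2}]
    itself occurs only in Condition 2 (ii), and disappears there because it commutes with the
    projections on the subjects. All fluctuations are measured against [rho = n R]. Once they are
    small, the comparison of the excess with the loss is a deterministic inequality of the form
    |excess| <= constant * c * loss, so that samples with zero loss need no separate treatment. *)

Definition bform k (A : 'M[R]_k) (u v : 'cV[R]_k) : R := (u^T *m A *m v) 0 0.
Definition qform k (A : 'M[R]_k) (v : 'cV[R]_k) : R := bform A v v.

Lemma bformDl k (A : 'M[R]_k) u1 u2 v : bform A (u1 + u2) v = bform A u1 v + bform A u2 v.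
Proof. by rewrite /bform linearD /= !mulmxDl mxE. Qed.
Lemma bformDr k (A : 'M[R]_k) u v1 v2 : bform A u (v1 + v2) = bform A u v1 + bform A u v2.
Proof. by rewrite /bform !mulmxDr mxE. Qed.
Lemma bformZl k (A : 'M[R]_k) a u v : bform A (a *: u) v = a * bform A u v.
Proof. by rewrite /bform linearZ /= -!scalemxAl mxE. Qed.
Lemma bformZr k (A : 'M[R]_k) a u v : bform A u (a *: v) = a * bform A u v.
Proof. by rewrite /bform -!scalemxAr mxE. Qed.
Lemma bformNl k (A : 'M[R]_k) u v : bform A (- u) v = - bform A u v.
Proof. by rewrite -scaleN1r bformZl mulN1r. Qed.
Lemma bformNr k (A : 'M[R]_k) u v : bform A u (- v) = - bform A u v.
Proof. by rewrite -scaleN1r bformZr mulN1r. Qed.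
Lemma bformBl k (A : 'M[R]_k) u1 u2 v : bform A (u1 - u2) v = bform A u1 v - bform A u2 v.
Proof. by rewrite bformDl bformNl. Qed.
Lemma bformBr k (A : 'M[R]_k) u v1 v2 : bform A u (v1 - v2) = bform A u v1 - bform A u v2.
Proof. by rewrite bformDr bformNr. Qed.

Lemma bformD k (A B : 'M[R]_k) u v : bform (A + B) u v = bform A u v + bform B u v.
Proof. by rewrite /bform mulmxDr mulmxDl mxE. Qed.
Lemma bformZ k (a : R) (A : 'M[R]_k) u v : bform (a *: A) u v = a * bform A u v.
Proof. by rewrite /bform -scalemxAr -scalemxAl mxE. Qed.
Lemma bformN k (A : 'M[R]_k) u v : bform (- A) u v = - bform A u v.
Proof. by rewrite -scaleN1r bformZ mulN1r. Qed.
Lemma bformB k (A B : 'M[R]_k) u v : bform (A - B) u v = bform A u v - bform B u v.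
Proof. by rewrite bformD bformN. Qed.
Lemma bform0 k (u v : 'cV[R]_k) : bform 0 u v = 0.
Proof. by rewrite /bform mulmx0 mul0mx mxE. Qed.
Lemma bform_sum k (I : finType) (A : I -> 'M[R]_k) u v :
  bform (\sum_i A i) u v = \sum_i bform (A i) u v.
Proof. by elim/big_rec2 : _ => [|i x B _ <-]; rewrite ?bform0 ?bformD. Qed.

Lemma bformC k (A : 'M[R]_k) u v : bform A u v = bform A^T v u.
Proof.
rewrite /bform; transitivity ((u^T *m A *m v)^T 0 0); first by rewrite [RHS]mxE.
by rewrite !trmx_mul !trmxK mulmxA.
Qed.

Lemma qform_congr k l (C : 'M[R]_(k, l)) (A : 'M[R]_k) (v : 'cV[R]_l) :
  qform A (C *m v) = qform (C^T *m A *m C) v.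
Proof. by rewrite /qform /bform trmx_mul !mulmxA. Qed.

Lemma sqnormE k (v : 'cV[R]_k) : sqnorm v = qform 1%:M v.
Proof. by rewrite /qform /bform mulmx1. Qed.

Lemma sqnorm_sum k (v : 'cV[R]_k) : sqnorm v = \sum_i v i 0 ^+ 2.
Proof. by rewrite /sqnorm mxE; apply: eq_bigr => i _; rewrite mxE. Qed.

Lemma sqnorm_ge0 k (v : 'cV[R]_k) : 0 <= sqnorm v.
Proof. by rewrite sqnorm_sum; apply: sumr_ge0 => i _; exact: sqr_ge0. Qed.

Lemma sqnorm_eq0 k (v : 'cV[R]_k) : sqnorm v = 0 -> v = 0.
Proof.
rewrite sqnorm_sum => /eqP; rewrite psumr_eq0 => [/allP h|i _]; last exact: sqr_ge0.
apply/matrixP => i j; rewrite ord1 mxE.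
by have := h i (mem_index_enum _); rewrite /= sqrf_eq0 => /eqP.
Qed.

Lemma sqnormM k l (C : 'M[R]_(k, l)) (v : 'cV[R]_l) : sqnorm (C *m v) = qform (C^T *m C) v.
Proof. by rewrite sqnormE qform_congr mulmx1. Qed.

Lemma mxtrace_qform k (A : 'M[R]_k) : \tr A = \sum_i qform A (delta_mx i 0).
Proof.
apply: eq_bigr => i _; rewrite /qform /bform trmx_delta -rowE -colE !mxE.
by [].
Qed.

(** Symmetry is not part of the order: two matrices are compared through their quadratic forms, that
    is, through their symmetric parts. *)
Definition loewner k (A B : 'M[R]_k) : Prop := forall v, qform A v <= qform B v.

Lemma loewner_trans k (B A C : 'M[R]_k) : loewner A B -> loewner B C -> loewner A C.
Proof. by move=> h1 h2 v; exact: le_trans (h1 v) (h2 v). Qed.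
Lemma loewnerZ k (a : R) (A B : 'M[R]_k) : 0 <= a -> loewner A B -> loewner (a *: A) (a *: B).
Proof. by move=> a0 h v; rewrite /qform !bformZ; apply: ler_wpM2l => //; exact: h. Qed.
Lemma loewner_sum k (I : finType) (A B : I -> 'M[R]_k) :
  (forall i, loewner (A i) (B i)) -> loewner (\sum_i A i) (\sum_i B i).
Proof. by move=> h v; rewrite /qform !bform_sum; apply: ler_sum => i _; exact: h. Qed.
Lemma loewner_congr k l (C : 'M[R]_(k, l)) (A B : 'M[R]_k) :
  loewner A B -> loewner (C^T *m A *m C) (C^T *m B *m C).
Proof. by move=> h v; rewrite -!qform_congr; exact: h. Qed.
Lemma loewner_trmx k (A B : 'M[R]_k) : loewner A B -> \tr A <= \tr B.
Proof. by move=> h; rewrite !mxtrace_qform; apply: ler_sum => i _; exact: h. Qed.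

Lemma psd_loewner k (A : 'M[R]_k) : possemidef A -> loewner 0 A.
Proof. by move=> [_ h] v; rewrite /qform bform0; exact: h. Qed.

Lemma psd_qform k (A : 'M[R]_k) v : possemidef A -> 0 <= qform A v.
Proof. by move=> [_]; apply. Qed.

Lemma posdef_psd k (A : 'M[R]_k) : posdef A -> possemidef A.
Proof.
move=> [As Ap]; split=> // v; have [->|/Ap/ltW//] := eqVneq v 0.
by rewrite mulmx0 mxE.
Qed.

Lemma psd_congr k l (C : 'M[R]_(k, l)) (A : 'M[R]_k) :
  possemidef A -> possemidef (C^T *m A *m C).
Proof.
move=> [As Ap]; split; first by rewrite !trmx_mul trmxK As mulmxA.
by move=> v; have := Ap (C *m v); rewrite trmx_mul !mulmxA.
Qed.

Lemma psdD k (A B : 'M[R]_k) : possemidef A -> possemidef B -> possemidef (A + B).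
Proof.
move=> [As Ap] [Bs Bp]; split; first by rewrite linearD /= As Bs.
by move=> v; rewrite mulmxDr mulmxDl mxE addr_ge0.
Qed.
Lemma psdZ k (a : R) (A : 'M[R]_k) : 0 <= a -> possemidef A -> possemidef (a *: A).
Proof.
move=> a0 [As Ap]; split; first by rewrite linearZ /= As.
by move=> v; rewrite -scalemxAr -scalemxAl mxE mulr_ge0.
Qed.
Lemma psd0 k : possemidef (0 : 'M[R]_k).
Proof. by split; rewrite ?trmx0// => v; rewrite mulmx0 mul0mx mxE. Qed.
Lemma psd_sum k (I : finType) (A : I -> 'M[R]_k) :
  (forall i, possemidef (A i)) -> possemidef (\sum_i A i).
Proof.
by move=> h; elim/big_ind : _ => [|B C|//]; [exact: psd0|exact: psdD].
Qed.
Lemma psd_gram k l (C : 'M[R]_(k, l)) : possemidef (C^T *m C).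
Proof.
split; first by rewrite trmx_mul trmxK.
by move=> v; have := sqnorm_ge0 (C *m v); rewrite sqnormM.
Qed.
Lemma psd1 k : possemidef (1%:M : 'M[R]_k).
Proof. by rewrite -[1%:M]mulmx1 -[X in X *m _]trmx1; exact: psd_gram. Qed.

Lemma psd_tr_ge0 k (A : 'M[R]_k) : possemidef A -> 0 <= \tr A.
Proof. by move=> /psd_loewner /loewner_trmx; rewrite mxtrace0. Qed.

Lemma posdef_unit k (A : 'M[R]_k) : posdef A -> A \in unitmx.
Proof.
move=> [As Ap]; rewrite -row_free_unit -kermx_eq0; apply/eqP/row_matrixP => i.
rewrite row0; apply/eqP; apply: contraT => r0.
have : 0 < ((row i (kermx A))^T^T *m A *m (row i (kermx A))^T) 0 0.
  by apply: Ap; rewrite -trmx0 (inj_eq trmx_inj).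
by rewrite trmxK -row_mul mulmx_ker row0 mul0mx mxE ltxx.
Qed.

Lemma posdef_inv k (A : 'M[R]_k) : posdef A -> posdef (invmx A).
Proof.
move=> pA; have uA := posdef_unit pA; case: pA => As Ap.
split; first by rewrite trmx_inv As.
move=> v v0; have := Ap (invmx A *m v).
rewrite trmx_mul trmx_inv As -!mulmxA mulKVmx//.
apply; apply: contra_neq v0 => h.
by rewrite -(mulKVmx uA v) h mulmx0.
Qed.

(** A zero [v] of a nonnegative form is a minimiser, so the first variation [bform A u v] vanishes
    in every direction [u]; the direction [u = A v] then gives |A v|^2 = 0. *)
Lemma psd_ker k (A : 'M[R]_k) v : possemidef A -> qform A v = 0 -> A *m v = 0.
Proof.
move=> [As Ap] q0.
have h t u : 0 <= t * (bform A u v *+ 2 + t * qform A u).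
  have := Ap (v + t *: u); rewrite -/(bform A _ _) bformDl !bformDr !bformZl !bformZr.
  rewrite [bform A v v]q0 add0r [bform A v u]bformC As => h.
  by apply: le_trans h _; rewrite /qform mulr2n le_eqVlt; apply/orP; left; apply/eqP; ring.
have {h} h u : bform A u v = 0.
  have c0 : 0 <= qform A u by exact: Ap.
  set a := bform A u v; set c := qform A u in c0.
  (* The minimising step would be [- a / c], which is meaningless for [c = 0]; with [c + 1] the
     value is still negative unless [a = 0]. *)
  have := h (- a / (c + 1)) u; rewrite -/a -/c => h1.
  have c1 : c + 1 != 0 by rewrite gt_eqF// ltr_wpDl.
  have : - a / (c + 1) * (a *+ 2 + - a / (c + 1) * c) = - (a ^+ 2 * (c + 2) / (c + 1) ^+ 2).
    by rewrite mulr2n; field.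
  move=> e; move: h1; rewrite e oppr_ge0 pmulr_lle0; last first.
    by rewrite invr_gt0 exprn_gt0// ltr_wpDl.
  rewrite pmulr_lle0; last by rewrite ltr_wpDl.
  by move=> h1; apply/eqP; rewrite -sqrf_eq0 eq_le h1 sqr_ge0.
by apply: sqnorm_eq0; rewrite /sqnorm -[RHS](h (A *m v)) /bform !mulmxA.
Qed.

Lemma psd_unit_posdef k (A : 'M[R]_k) : possemidef A -> A \in unitmx -> posdef A.
Proof.
move=> pA uA; have [As Ap] := pA; split=> // v v0; rewrite lt_neqAle Ap andbT eq_sym.
apply: contra_neq v0 => q0.
by rewrite -(mulKmx uA v) (psd_ker pA q0) mulmx0.
Qed.

End BilinearForms.

(** * Rayleigh quotients and square roots *)

Section Spectral.
Context {R : realType}.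
Local Open Scope classical_set_scope.

Lemma continuous_qform_row k (A : 'M[R]_k) : continuous (fun v : 'rV[R]_k => qform A v^T).
Proof.
have -> : (fun v : 'rV[R]_k => qform A v^T) =
    fun v => \sum_j \sum_i v 0 i * A i j * v 0 j.
  apply/funext => v; rewrite /qform /bform trmxK mxE; apply: eq_bigr => j _.
  by rewrite !mxE mulr_suml.
apply: continuous_big => [|j _]; first exact: add_continuous.
apply: continuous_big => [|i _ v]; first exact: add_continuous.
apply: (@cvgM R _ (nbhs v) _ (fun x : 'rV[R]_k => x 0 i * A i j) (fun x => x 0 j)).
  by apply: (@cvgMr_tmp R _ (nbhs v) _ (fun x : 'rV[R]_k => x 0 i)); exact: coord_continuous.
exact: coord_continuous.
Qed.

Lemma compact_sphere k : compact [set v : 'rV[R]_k | sqnorm v^T = 1].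
Proof.
apply: bounded_closed_compact.
- exists 1; split; first exact: num_real.
  move=> M M1 v /= v1; rewrite [`|v|]mx_normrE; apply/bigmax_leP; split; first by rewrite ltW// (lt_trans _ M1).
  move=> [i j] _ /=; rewrite ord1; apply: le_trans (ltW M1).
  rewrite -ler_sqr ?nnegrE// expr1n -v1 sqnorm_sum (bigD1 j)//= mxE real_normK ?num_real//.
  by rewrite lerDl sumr_ge0// => l _; exact: sqr_ge0.
- rewrite (_ : [set _ | _] = (fun v : 'rV[R]_k => qform 1%:M v^T) @^-1` [set 1]); last first.
    by apply/seteqP; split=> v /=; rewrite sqnormE.
  by apply: closed_comp => [v _|]; [exact: continuous_qform_row|exact: closed_eq].
Qed.

(** The quotient of the two forms attains its maximum [s] on the compact unit sphere. Then [s Q - S]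
    is positive semi-definite and its form vanishes at the maximiser, which [psd_ker] turns into the
    eigenvector equation. *)
Lemma rayleigh_max k (S Q : 'M[R]_k) : (0 < k)%N -> S^T = S -> posdef Q ->
  exists (s : R) (v : 'cV[R]_k), [/\ v != 0, S *m v = s *: (Q *m v) & loewner S (s *: Q)].
Proof.
move=> k0 Ss pQ; have [Qs Qp] := pQ.
pose f (v : 'rV[R]_k) := qform S v^T / qform Q v^T.
have nz (v : 'rV[R]_k) : sqnorm v^T = 1 -> 0 < qform Q v^T.
  move=> v1; apply: Qp; apply: contraPneq v1 => ->.
  by rewrite /sqnorm mulmx0 mxE => /esym/eqP; rewrite oner_eq0.
have [|||v vA vmax] := @EVT_max_rV R k f [set v | sqnorm v^T = 1].
- exists (delta_mx 0 (Ordinal k0)); rewrite /= trmx_delta.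
  by rewrite /sqnorm trmx_delta mul_delta_mx mxE !eqxx.
- exact: compact_sphere.
- apply: continuous_in_subspaceT => v /set_mem v1.
  apply: (@cvgM R _ (nbhs v) _ (fun x => qform S x^T) (fun x => (qform Q x^T)^-1)).
    exact: continuous_qform_row.
  apply: (@cvgV R _ (nbhs v) _ (fun x => qform Q x^T)); last exact: continuous_qform_row.
  by rewrite gt_eqF// nz.
move: vA => /set_mem /= v1; exists (f v), v^T.
have v0 : v^T != 0.
  by apply: contraPneq v1 => ->; rewrite /sqnorm mulmx0 mxE => /esym/eqP; rewrite oner_eq0.
have le : loewner S (f v *: Q).
  move=> u; have [->|u0] := eqVneq u 0; first by rewrite /qform /bform !mulmx0 !mxE.
  have nu : 0 < sqnorm u.
    by rewrite lt_neqAle sqnorm_ge0 andbT eq_sym; apply: contra_neq u0 => /sqnorm_eq0.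
  pose c := (Num.sqrt (sqnorm u))^-1.
  have c0 : 0 < c by rewrite invr_gt0 sqrtr_gt0.
  have cu1 : sqnorm (c *: u) = 1.
    rewrite sqnormE /qform bformZl bformZr -/(qform _ _) -sqnormE mulrA -expr2.
    by rewrite exprVn sqr_sqrtr ?sqnorm_ge0// mulVf// gt_eqF.
  have := vmax (c *: u)^T; rewrite inE /= trmxK => /(_ cu1).
  rewrite {1}/f trmxK ler_pdivrMr; last first.
    by have := nz (c *: u)^T; rewrite trmxK; exact.
  rewrite /qform bformZ !bformZl !bformZr !mulrA -expr2.
  move=> h; rewrite -(ler_pM2l (exprn_gt0 2 c0)); apply: le_trans h _.
  by rewrite le_eqVlt; apply/orP; left; apply/eqP; ring.
split=> //.
have psd : possemidef (f v *: Q - S).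
  split; first by rewrite linearB linearZ /= Qs Ss.
  by move=> u; rewrite -/(bform _ _ _) bformB subr_ge0; exact: le.
have := psd_ker (v := v^T) psd; rewrite /qform bformB bformZ.
rewrite -/(qform Q v^T) -/(qform S v^T) {1}/f divfK ?gt_eqF ?nz// subrr => /(_ erefl).
by rewrite mulmxBl -scalemxAl => /eqP; rewrite subr_eq0 => /eqP.
Qed.

(* Deflation: subtracting the top eigencomponent of [A] lowers its rank. *)
Lemma psd_sqrt_exists k (A : 'M[R]_k) : possemidef A -> exists B, possemidef B /\ B *m B = A.
Proof.
have [m] := ubnP (\rank A); elim: m A => // m IH A rA pA.
have [k0|k0] := posnP k.
  by exists 0; split; [exact: psd0|subst k; rewrite mulmx0; apply/matrixP => -[]].
have [As Ap] := pA.
have p1 : posdef (1%:M : 'M[R]_k) by apply: psd_unit_posdef; [exact: psd1|exact: unitmx1].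
have [s [w [w0 Aw le]]] := rayleigh_max k0 As p1.
rewrite mul1mx in Aw.
have nw : 0 < sqnorm w.
  by rewrite lt_neqAle sqnorm_ge0 andbT eq_sym; apply: contra_neq w0 => /sqnorm_eq0.
pose v := (Num.sqrt (sqnorm w))^-1 *: w.
have Av : A *m v = s *: v by rewrite /v -scalemxAr Aw !scalerA mulrC.
have vv : v^T *m v = 1%:M.
  apply/matrixP => i j; rewrite !ord1 -/(sqnorm v) sqnormE /qform bformZl bformZr.
  rewrite -/(qform _ _) -sqnormE mulrA -expr2 exprVn sqr_sqrtr ?sqnorm_ge0//.
  by rewrite mulVf ?gt_eqF// mxE.
clearbody v.
have vA : v^T *m A = s *: v^T by rewrite -[in LHS]As -trmx_mul Av linearZ.
have s0 : 0 <= s.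
  have := Ap v; rewrite vA -scalemxAl vv.
  by rewrite !mxE eqxx mulr1.
have [s00|sn0] := eqVneq s 0.
  have -> : A = 0.
    apply/matrixP => i j; have Aj0 : A *m delta_mx j 0 = 0 :> 'cV_k.
      apply: psd_ker pA _; apply/eqP; rewrite eq_le [X in _ && X]psd_qform// andbT.
      by apply: le_trans (le _) _; rewrite s00 scale0r /qform bform0.
    by move/matrixP: Aj0 => /(_ i 0); rewrite -colE !mxE.
  by exists 0; split; [exact: psd0|rewrite mulmx0].
pose A' := A - s *: (v *m v^T).
have A'v : A' *m v = 0.
  by rewrite mulmxBl Av -scalemxAl -mulmxA vv mulmx1 subrr.
have A's : A'^T = A' by rewrite linearB linearZ /= As trmx_mul trmxK.
have vA' : v^T *m A' = 0 by rewrite -[in LHS]A's -trmx_mul A'v trmx0.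
have pA' : possemidef A'.
  (* [A'] is the compression of [A] to the orthogonal complement of [v], hence a congruence of
     [A]. *)
  split=> // u; pose P := 1%:M - v *m v^T.
  have A'P : P^T *m A *m P = A'.
    have Ps : P^T = P by rewrite /P linearB /= trmx1 trmx_mul trmxK.
    rewrite Ps {1}/P mulmxBl mul1mx -mulmxA vA -scalemxAr.
    rewrite -/A' /P mulmxBr mulmx1 [A' *m _]mulmxA A'v mul0mx.
    by rewrite subr0.
  by rewrite -A'P; have [_] := psd_congr P pA; apply.
have rA' : (\rank A' < m)%N.
  apply: (@leq_trans (\rank A)); last by rewrite -ltnS.
  apply: rank_ltmx; rewrite /ltmx; apply/andP; split.
    have -> : A' = (1%:M - v *m v^T) *m A by rewrite mulmxBl mul1mx -mulmxA vA -scalemxAr.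
    exact: submxMl.
  (* The inclusion of row spaces is strict: [v^T] is a row combination of [A] because
     [v^T A = s v^T] with [s != 0], but not of [A'], since [A' v = 0] while [v^T v = 1]. *)
  apply/negP => /(submx_trans _) h.
  have /h /submxP [D vD] : (v^T <= A)%MS.
    by rewrite -[v^T](scalerK sn0) -vA scalemx_sub// submxMl.
  have /eqP : v^T *m v = 0 by rewrite vD -mulmxA A'v mulmx0.
  rewrite vv => /eqP/matrixP/(_ 0 0); rewrite !mxE eqxx => /eqP.
  by rewrite oner_eq0.
have [B [pB BB]] := IH A' rA' pA'; have [Bs Bp] := pB.
have Bv : B *m v = 0.
  apply: sqnorm_eq0; rewrite sqnormM Bs BB /qform /bform -mulmxA A'v mulmx0 mxE //.
have vB : v^T *m B = 0 by rewrite -[in LHS]Bs -trmx_mul Bv trmx0.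
exists (B + Num.sqrt s *: (v *m v^T)); split.
  apply: psdD => //; apply: psdZ; first exact: sqrtr_ge0.
  by rewrite -[X in X *m _]trmxK; exact: psd_gram.
rewrite mulmxDl !mulmxDr BB -!scalemxAl -!scalemxAr -!mulmxA.
rewrite (_ : v^T *m (v *m v^T) = v^T); last by rewrite mulmxA vv mul1mx.
rewrite vB mulmx0 scaler0 add0r.
rewrite mulmxA Bv mul0mx scaler0 addr0.
by rewrite scalerA -expr2 sqr_sqrtr// subrK.
Qed.

Lemma sqrtmxP k (A : 'M[R]_k) : possemidef A ->
  possemidef (sqrtmx A) /\ sqrtmx A *m sqrtmx A = A.
Proof. by move=> /psd_sqrt_exists [B hB]; rewrite /sqrtmx; case: xgetP => //= /(_ B hB). Qed.

End Spectral.

(** * Loewner bounds by traces and largest eigenvalues *)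

Section LoewnerTraces.
Context {R : realType}.

Lemma posdef1 k : posdef (1%:M : 'M[R]_k).
Proof. by apply: psd_unit_posdef; [exact: psd1|exact: unitmx1]. Qed.

Lemma sqrtmx_tr k (A : 'M[R]_k) : possemidef A -> (sqrtmx A)^T = sqrtmx A.
Proof. by move=> /sqrtmxP[[]]. Qed.

Lemma sqrtmx_unit k (A : 'M[R]_k) : posdef A -> sqrtmx A \in unitmx.
Proof.
move=> pA; have [_ SS] := sqrtmxP (posdef_psd pA).
by have := posdef_unit pA; rewrite -{1}SS unitmx_mul => /andP[].
Qed.

Lemma mxtraceM_ge0 k (A B : 'M[R]_k) : possemidef A -> possemidef B -> 0 <= \tr (A *m B).
Proof.
move=> pA pB; have [[Ss _] SS] := sqrtmxP pA.
rewrite -SS -mulmxA mxtrace_mulC -[X in X *m B]Ss.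
by apply: psd_tr_ge0; exact: psd_congr.
Qed.

Lemma loewner_mxtraceM k (P A B : 'M[R]_k) :
  possemidef P -> loewner A B -> \tr (P *m A) <= \tr (P *m B).
Proof.
move=> pP AB; have [[Ss _] SS] := sqrtmxP pP.
rewrite -SS -!mulmxA ![\tr (sqrtmx P *m _)]mxtrace_mulC -[X in X *m A]Ss -[X in X *m B]Ss.
by apply: loewner_trmx; exact: loewner_congr.
Qed.

Lemma bform_CauchySchwarz k (A : 'M[R]_k) u v : possemidef A ->
  bform A u v ^+ 2 <= qform A u * qform A v.
Proof.
move=> pA; have [As Ap] := pA.
have [v0|v0] := eqVneq (qform A v) 0.
  by rewrite /bform -mulmxA (psd_ker pA v0) mulmx0 mxE expr0n /= v0 mulr0.
have vp : 0 < qform A v by rewrite lt_neqAle eq_sym v0 psd_qform.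
have := psd_qform (qform A v *: u - bform A u v *: v) pA.
rewrite /qform bformBl !bformBr !bformZl !bformZr -!/(qform _ _) [bform A v u]bformC As.
set a := bform A u v; set q := qform A v in v0 vp *; set p := qform A u => h.
rewrite -subr_ge0 -(pmulr_rge0 _ vp).
by apply: le_trans h _; rewrite le_eqVlt; apply/orP; left; apply/eqP; ring.
Qed.

(** With [S] the square root of [A], Cauchy-Schwarz on each row of [S] bounds |S v|^2 by |v|^2 times
    the sum of the squared row norms, which is [tr A]. A trace is wanted here, and not the largest
    eigenvalue, because Condition 2 controls traces of blocks. *)
Lemma psd_loewner_tr k (A : 'M[R]_k) : possemidef A -> loewner A (\tr A *: 1%:M).
Proof.
move=> pA v; have [_ SS] := sqrtmxP pA; have Ss := sqrtmx_tr pA.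
set S := sqrtmx A in SS Ss.
rewrite /qform bformZ -/(qform _ _) -/(qform _ _) -SS -{1}Ss -sqnormM sqnorm_sum.
rewrite mulr_suml; apply: ler_sum => i _.
have -> : (S *m v) i 0 = bform 1%:M (row i S)^T v.
  by rewrite /bform mulmx1 trmxK -row_mul [RHS]mxE.
apply: le_trans (bform_CauchySchwarz _ _ (psd1 _)) _.
apply: ler_wpM2r; first exact/psd_qform/psd1.
rewrite /qform /bform mulmx1 trmxK le_eqVlt; apply/orP; left; apply/eqP.
rewrite !mxE; apply: eq_bigr => j _; rewrite !mxE.
by congr (_ * _); rewrite -[in RHS]Ss mxE.
Qed.

Lemma psd_mxtrace0 k (A : 'M[R]_k) : possemidef A -> \tr A = 0 -> A = 0.
Proof.
move=> pA t0; apply/matrixP => i j.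
have Aj0 : A *m delta_mx j 0 = 0 :> 'cV_k.
  apply: (psd_ker pA); apply/eqP; rewrite eq_le; apply/andP; split; last exact: (psd_qform _ pA).
  by apply: le_trans (psd_loewner_tr pA _) _; rewrite t0 scale0r /qform bform0.
by move/matrixP: Aj0 => /(_ i 0); rewrite -colE !mxE.
Qed.

(** [G V G] is [G^{1/2} T G^{1/2}] with [T = G^{1/2} V G^{1/2}], and [T] is at most its trace
    [tr (G V)]. This is how the traces of the [A_ii] enter the bounds. *)
Lemma psd_sandwich_tr k (G V : 'M[R]_k) : possemidef G -> possemidef V ->
  loewner (G *m V *m G) (\tr (G *m V) *: G).
Proof.
move=> pG pV; have [[Ss _] SS] := sqrtmxP pG; set S := sqrtmx G in Ss SS.
have pT : possemidef (S *m V *m S) by rewrite -{1}Ss; exact: psd_congr.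
have tE : \tr (S *m V *m S) = \tr (G *m V) by rewrite mxtrace_mulC mulmxA SS.
have := loewner_congr S (psd_loewner_tr pT).
by rewrite tE Ss -scalemxAr mulmx1 -scalemxAl SS -!mulmxA SS !mulmxA SS.
Qed.

Lemma invmx_sqrtmx_sqr k (W : 'M[R]_k) : posdef W ->
  invmx (sqrtmx (invmx W)) *m invmx (sqrtmx (invmx W)) = W.
Proof.
move=> pW; have pV := posdef_inv pW; have [_ SS] := sqrtmxP (posdef_psd pV).
have uS := sqrtmx_unit pV; apply: (can_inj (mulKmx (posdef_unit pV))).
by rewrite -{1}SS mulmxA mulmxK// mulmxV// mulVmx// posdef_unit.
Qed.

(** The bound by the trace is applied after whitening, to [V^{1/2} G V^{1/2}] with [V = W^-1], and
    transported back. *)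
Lemma psd_loewner_tr_posdef k (G W : 'M[R]_k) : possemidef G -> posdef W ->
  loewner G (\tr (G *m invmx W) *: W).
Proof.
move=> pG pW v; have pV := posdef_inv pW; have uV := posdef_unit pV.
have [_ SS] := sqrtmxP (posdef_psd pV); have Ss := sqrtmx_tr (posdef_psd pV).
have uS := sqrtmx_unit pV; set S := sqrtmx _ in SS Ss uS.
have pT : possemidef (S *m G *m S) by rewrite -{1}Ss; exact: psd_congr.
have tE : \tr (S *m G *m S) = \tr (G *m invmx W) by rewrite -mulmxA mxtrace_mulC -mulmxA SS.
have := psd_loewner_tr pT (invmx S *m v).
rewrite tE !qform_congr trmx_inv Ss -!mulmxA mulmxV// mulmx1 mulKmx//.
by rewrite -scalemxAl mul1mx -scalemxAr invmx_sqrtmx_sqr.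
Qed.

Lemma loewner_inv k (W : 'M[R]_k) (a : R) : posdef W -> loewner W (a *: 1%:M) ->
  loewner 1%:M (a *: invmx W).
Proof.
move=> pW Wa; have pV := posdef_inv pW; have uV := posdef_unit pV.
have [_ SS] := sqrtmxP (posdef_psd pV); have Ss := sqrtmx_tr (posdef_psd pV).
have uS := sqrtmx_unit pV; set S := sqrtmx _ in SS Ss uS.
have := loewner_congr S Wa; rewrite Ss -scalemxAr mulmx1 -scalemxAl SS.
have := invmx_sqrtmx_sqr pW; rewrite -/S => {1}<-.
by rewrite mulmxA mulmxV// mul1mx mulVmx.
Qed.

(** For [C = sqrtmx A] and [D = B - C], the equality of squares reads [B D + D C = 0]. Multiplying
    by [D] and taking the trace gives two nonnegative traces of sum zero, so [D B D = 0]; as [B] is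
    invertible, hence positive definite, [D = 0]. *)
Lemma sqrtmx_unique k (A B : 'M[R]_k) : posdef A -> possemidef B -> B *m B = A ->
  B = sqrtmx A.
Proof.
move=> pA pB BB; have [pC CC] := sqrtmxP (posdef_psd pA); set C := sqrtmx A in pC CC *.
have pB' : posdef B.
  apply: psd_unit_posdef => //.
  by have := posdef_unit pA; rewrite -BB unitmx_mul => /andP[].
have [Bs _] := pB; have [Cs _] := pC.
pose D := B - C.
have Ds : D^T = D by rewrite /D linearB /= Bs Cs.
have e : B *m D + D *m C = 0.
  by rewrite /D mulmxBr mulmxBl BB CC addrA subrK subrr.
have : \tr (D *m B *m D) + \tr (D *m C *m D) = 0.
  rewrite [X in _ + X]mxtrace_mulC -mxtraceD -[X in X + _]mulmxA -mulmxDr e.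
  by rewrite mulmx0 mxtrace0.
have pDBD : possemidef (D *m B *m D) by rewrite -{1}Ds; exact: psd_congr.
have pDCD : possemidef (D *m C *m D) by rewrite -{1}Ds; exact: psd_congr.
move/eqP; rewrite paddr_eq0 ?psd_tr_ge0// => /andP[/eqP /(psd_mxtrace0 pDBD) D0 _].
suff : D = 0 by move/eqP; rewrite subr_eq0 => /eqP.
apply/matrixP => i j.
have Dj : D *m delta_mx j 0 = 0 :> 'cV_k.
  apply/eqP; apply: contraT => /(proj2 pB').
  rewrite trmx_mul Ds !mulmxA -[_ *m D *m B]mulmxA -[_ *m (D *m B) *m D]mulmxA D0.
  by rewrite mulmx0 mul0mx mxE ltxx.
by move/matrixP: Dj => /(_ i 0); rewrite -colE !mxE.
Qed.

(* The reflection [1 - 2 P] fixes [W] by conjugation, hence also its unique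
   square root. *)
Lemma sqrtmx_comm k (W P : 'M[R]_k) : posdef W -> P^T = P -> P *m P = P ->
  P *m W = W *m P -> P *m sqrtmx W = sqrtmx W *m P.
Proof.
move=> pW Ps PP PW; have [pS SS] := sqrtmxP (posdef_psd pW).
pose U : 'M[R]_k := 1%:M - 2 *: P.
have Us : U^T = U by rewrite /U linearB linearZ /= trmx1 Ps.
have UU : U *m U = 1%:M.
  rewrite /U mulmxBr mulmx1 -scalemxAr mulmxBl mul1mx -scalemxAl PP.
  by apply/matrixP => i j; rewrite !mxE; ring.
have UW : U *m W = W *m U.
  by rewrite /U mulmxBl mulmxBr mul1mx mulmx1 -scalemxAl -scalemxAr PW.
have e : U *m sqrtmx W *m U = sqrtmx W.
  apply: sqrtmx_unique => //; first by rewrite -{1}Us; exact: psd_congr.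
  rewrite -!mulmxA [U *m (U *m _)]mulmxA UU mul1mx [sqrtmx W *m (sqrtmx W *m _)]mulmxA SS.
  by rewrite -UW mulmxA UU mul1mx.
have {e} : U *m sqrtmx W = sqrtmx W *m U.
  by rewrite -{2}e -!mulmxA UU mulmx1.
rewrite /U mulmxBl mulmxBr mul1mx mulmx1 -scalemxAl -scalemxAr => /addrI/oppr_inj.
by apply: scalerI; rewrite pnatr_eq0.
Qed.

Lemma eigenvalue_pencil_le k (S Q : 'M[R]_k) s a : posdef Q ->
  loewner S (s *: Q) -> eigenvalue (S *m invmx Q) a -> a <= s.
Proof.
move=> pQ le /eigenvalueP[u uE u0]; have uQ := posdef_unit pQ.
have uS : u *m S = a *: (u *m Q).
  by have := congr1 (mulmx^~ Q) uE; rewrite /= mulmxA mulmxKV// -scalemxAl.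
have := le u^T; rewrite /qform bformZ /bform trmxK uS -scalemxAl [X in X <= _]mxE.
rewrite ler_pM2r//; have := proj2 pQ u^T; rewrite trmxK; apply.
by rewrite -trmx0 (inj_eq trmx_inj).
Qed.

(** [S Q^-1] need not be symmetric, but its real eigenvalues are those of the pencil [(S, Q)]. The
    Rayleigh maximum is one of them and bounds the others, so the supremum that defines [lambda_max]
    is over a nonempty bounded set. *)
Lemma lambda_max_pencil k (S Q : 'M[R]_k) : (0 < k)%N -> S^T = S -> posdef Q ->
  loewner S (lambda_max (S *m invmx Q) *: Q).
Proof.
move=> k0 Ss pQ; have [s [v [v0 Sv le]]] := rayleigh_max k0 Ss pQ.
have uQ := posdef_unit pQ; have [Qs _] := pQ.
apply: (loewner_trans le) => w; rewrite /qform !bformZ.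
apply: ler_wpM2r; first exact/psd_qform/posdef_psd.
have sE : eigenvalue (S *m invmx Q) s.
  (* Eigenvectors are rows here, so the column relation [S v = s Q v] is transposed. *)
  apply/eigenvalueP; exists v^T; last by rewrite -trmx0 (inj_eq trmx_inj).
  rewrite mulmxA -[X in _ *m X *m _]Ss -trmx_mul Sv linearZ /= trmx_mul Qs.
  by rewrite -scalemxAl mulmxK.
rewrite /lambda_max; apply: sup_upper_bound => //; split; first by exists s.
by exists s => a /= aE; exact: eigenvalue_pencil_le aE.
Qed.

Lemma lambda_max_sym k (W : 'M[R]_k) : (0 < k)%N -> W^T = W ->
  loewner W (lambda_max W *: 1%:M).
Proof.
by move=> k0 Ws; have := lambda_max_pencil k0 Ws (posdef1 k); rewrite invmx1 mulmx1.
Qed.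

Lemma posdef_loewner_gt0 k (S Q : 'M[R]_k) a : (0 < k)%N -> posdef S -> possemidef Q ->
  loewner S (a *: Q) -> 0 < a.
Proof.
move=> k0 [_ Sp] pQ le; pose v : 'cV[R]_k := const_mx 1.
have v0 : v != 0.
  by apply/eqP => /matrixP/(_ (Ordinal k0) 0); rewrite !mxE => /eqP; rewrite oner_eq0.
have := lt_le_trans (Sp _ v0) (le v); rewrite /qform bformZ => h.
by rewrite -(pmulr_lgt0 _ (_ : 0 < bform Q v v)) // lt_neqAle [_ <= _](psd_qform v pQ) andbT eq_sym; apply: contraPneq h => ->; rewrite mulr0 ltxx.
Qed.

End LoewnerTraces.

(** * Loewner bounds on the smoother *)

Section HatBounds.
Context {R : realType}.

Lemma invmx_comm N (W P : 'M[R]_N) : W \in unitmx -> P *m W = W *m P ->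
  P *m invmx W = invmx W *m P.
Proof.
move=> uW PW; apply: (can_inj (mulKmx uW)).
by rewrite mulmxA -PW mulmxK// mulmxA mulmxV// mul1mx.
Qed.

(** The defect [H - H W^-1 H] is a congruence of the penalty, since [X^T W^-1 X = M - Pen]. It
    measures the shrinkage: with no penalty it is zero and [H W^-1] is a projection. *)
Lemma loewner_hat N q (W : 'M[R]_N) (X : 'M[R]_(N, q)) (Pen : 'M[R]_q)
    (M := X^T *m invmx W *m X + Pen) (H := X *m invmx M *m X^T) :
  posdef W -> possemidef Pen -> M \in unitmx ->
  possemidef H /\ loewner (H *m invmx W *m H) H.
Proof.
move=> pW pPen uM; have pV := posdef_psd (posdef_inv pW).
have pM : posdef M.
  apply: psd_unit_posdef uM; apply: psdD pPen; exact: psd_congr.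
have pMi := posdef_inv pM; have [Mis _] := pMi.
have pH : possemidef H by rewrite /H -{1}[X]trmxK; exact: psd_congr (posdef_psd pMi).
split=> // v; have e : H - H *m invmx W *m H = (invmx M *m X^T)^T *m Pen *m (invmx M *m X^T).
  rewrite trmx_mul trmxK Mis.
  have -> : Pen = M - X^T *m invmx W *m X by rewrite /M [_ + Pen]addrC addrK.
  by rewrite [in RHS]mulmxBr mulmxBl mulmxKV// !mulmxA.
by rewrite -subr_ge0 /qform -bformB e; exact/psd_qform/psd_congr.
Qed.

(** In the application [P i] is the coordinate projection on subject [i], and [s], [l], [kap] are
    the largest eigenvalues of [Sigma W^-1], [W] and [W^-1]. Thus [s * l] is xi, and [l * kap] is
    the condition number of [W] in Condition 5. *)
Context {N n : nat} {W S H A : 'M[R]_N} {P : 'I_n -> 'M[R]_N} {s l kap : R}.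
Context (pW : posdef W) (pS : posdef S) (pH : possemidef H) (AE : A = H *m invmx W)
  (Hle : loewner (H *m invmx W *m H) H)
  (Ps : forall i, (P i)^T = P i) (PP : forall i, P i *m P i = P i)
  (P0 : forall i j, i != j -> P i *m P j = 0) (P1 : \sum_i P i = 1%:M)
  (PW : forall i, P i *m W = W *m P i)
  (s0 : 0 <= s) (l0 : 0 <= l) (k0 : 0 <= kap)
  (Ss : loewner S (s *: W)) (Wl : loewner W (l *: 1%:M))
  (Vk : loewner (invmx W) (kap *: 1%:M)).

Let V := invmx W.
Let uW : W \in unitmx := posdef_unit pW.
Let pV : possemidef V := posdef_psd (posdef_inv pW).
Let Vs : V^T = V := proj1 pV.
Let Hs : H^T = H := proj1 pH.
Let PV i : P i *m V = V *m P i := invmx_comm uW (PW i).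

Let trA : A^T = V *m H. Proof. by rewrite AE trmx_mul Vs Hs. Qed.

(** The matrix [(W - H) V (W - H) = W - 2 H + H V H] is positive semi-definite, and [H V H <= H]
    absorbs one copy of [H]. *)
Lemma loewner_Hat_le : loewner H W.
Proof.
move=> v; have := psd_qform ((W - H) *m v) pV; rewrite qform_congr.
have -> : (W - H)^T = W - H by rewrite linearB /= Hs (proj1 pW).
rewrite mulmxBl mulmxV// mulmxBl mul1mx.
rewrite mulmxBr -!mulmxA mulVmx// mulmx1 mulmxA.
rewrite /qform !bformB; have := Hle v; rewrite /qform => h1 h2.
by lra.
Qed.

Lemma loewner_cov_le : loewner S ((s * l) *: 1%:M).
Proof.
by apply: loewner_trans Ss _; rewrite -scalerA; exact: loewnerZ.
Qed.

(** The chain is [A S A^T <= s A W A^T = s H V H <= s H <= s W <= s l]. *)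
Lemma loewner_fit_cov : loewner (A *m S *m A^T) ((s * l) *: 1%:M).
Proof.
have := loewner_congr A^T Ss; rewrite trmxK -scalemxAr -scalemxAl => h.
apply: loewner_trans h _; rewrite -scalerA; apply: loewnerZ => //.
rewrite trA AE -!mulmxA [V *m (W *m _)]mulmxA mulVmx// mul1mx mulmxA.
apply: loewner_trans Hle _; apply: loewner_trans loewner_Hat_le _; exact: Wl.
Qed.

Lemma psd_cov_congr (B : 'M[R]_N) : possemidef (B *m S *m B^T).
Proof. by rewrite -{1}[B]trmxK; exact: psd_congr (posdef_psd pS). Qed.

Lemma mxtrace_quad_le (B : 'M[R]_N) :
  \tr (B *m S *m B^T *m S) <= s * l * \tr (B *m S *m B^T).
Proof.
apply: le_trans (loewner_mxtraceM (psd_cov_congr B) loewner_cov_le) _.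
by rewrite -scalemxAr mulmx1 mxtraceZ.
Qed.

Lemma mxtrace_fit_le : \tr (A^T *m A *m S *m (A^T *m A)^T *m S)
  <= s * l * \tr (A *m S *m A^T).
Proof.
rewrite [(A^T *m A)^T]trmx_mul trmxK.
have -> : \tr (A^T *m A *m S *m (A^T *m A) *m S) = \tr (A *m S *m A^T *m (A *m S *m A^T)).
  by rewrite -!mulmxA mxtrace_mulC -!mulmxA.
apply: le_trans (loewner_mxtraceM (psd_cov_congr A) loewner_fit_cov) _.
by rewrite -scalemxAr mulmx1 mxtraceZ.
Qed.

(** This serves the degenerate case of Condition 4, where the denominator vanishes and the ratio
    carries no information. *)
Lemma mxtrace_fit0 : \tr (A *m S *m A^T) = 0 -> A = 0.
Proof.
move=> /(psd_mxtrace0 (psd_cov_congr A)) e.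
suff : A^T = 0 by move/(congr1 trmx); rewrite trmxK trmx0.
apply/matrixP => i j.
have Aj : A^T *m delta_mx j 0 = 0 :> 'cV_N.
  apply/eqP; apply: contraT => /(proj2 pS).
  rewrite trmx_mul trmxK !mulmxA -[_ *m A *m S]mulmxA -[_ *m (A *m S) *m _]mulmxA e.
  by rewrite mulmx0 mul0mx mxE ltxx.
by move/matrixP: Aj => /(_ i 0); rewrite -colE !mxE.
Qed.

Definition blocktr i := \tr (P i *m A).
Let tau := blocktr.
Let G i := P i *m H *m P i.
Definition blockdiag_hat : 'M[R]_N := \sum_i P i *m A *m P i.
Let D := blockdiag_hat.
Let GG := \sum_i G i.
(** A symmetric substitute for the block diagonal [D = GG V]: one has [D W D^T = K],
    [D^T V D = V K V] and [D D = K V]. *)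
Let K := GG *m V *m GG.

Let pG i : possemidef (G i). Proof. by rewrite /G -{1}[P i]Ps; exact: psd_congr. Qed.
Let pGG : possemidef GG. Proof. exact: psd_sum. Qed.

Let tauE i : tau i = \tr (G i *m V).
Proof.
rewrite /tau /blocktr AE /G -[in RHS]mulmxA PV mulmxA [RHS]mxtrace_mulC.
by rewrite mulmxA -[V *m P i *m P i]mulmxA PP -[V *m P i *m H]mulmxA [RHS]mxtrace_mulC.
Qed.

Lemma blocktr_ge0 i : 0 <= tau i.
Proof. by rewrite tauE; apply: mxtraceM_ge0. Qed.

Let DE : D = GG *m V.
Proof.
rewrite /D /blockdiag_hat /GG mulmx_suml; apply: eq_bigr => i _.
by rewrite /G AE -!mulmxA PV.
Qed.

(** The projections commute with [V] and annihilate each other, so no cross term between subjects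
    remains. *)
Let KE : K = \sum_i G i *m V *m G i.
Proof.
rewrite /K {1}/GG !mulmx_suml; apply: eq_bigr => i _.
rewrite /GG mulmx_sumr (bigD1 i)//= big1 ?addr0// => j ij.
rewrite /G -!mulmxA [V *m (P j *m _)]mulmxA -PV -[_ *m V *m _]mulmxA [P i *m (P j *m _)]mulmxA.
by rewrite P0 1?eq_sym// mul0mx !mulmx0.
Qed.

Let pK : possemidef K. Proof. by rewrite /K -{1}(proj1 pGG); exact: psd_congr. Qed.

Let KG : loewner K (\sum_i tau i *: G i).
Proof. by rewrite KE; apply: loewner_sum => i; rewrite tauE; exact: psd_sandwich_tr. Qed.

Let GW i : loewner (G i) (tau i *: (P i *m W)).
Proof.
have := loewner_congr (P i) (psd_loewner_tr_posdef (pG i) pW).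
rewrite -/V -tauE Ps {1}/G !mulmxA PP -!mulmxA PP !mulmxA -/(G i) => h.
apply: loewner_trans h _.
by rewrite -scalemxAr -scalemxAl -mulmxA -PW mulmxA PP.
Qed.

Let psd_PW i : possemidef (P i *m W).
Proof.
have -> : P i *m W = (P i)^T *m W *m P i by rewrite Ps -mulmxA -PW mulmxA PP.
exact: psd_congr (posdef_psd pW).
Qed.

Let KW t : 0 <= t -> (forall i, tau i <= t) -> loewner K (t ^+ 2 *: W).
Proof.
move=> t0 ht; apply: loewner_trans KG _.
have -> : t ^+ 2 *: W = \sum_i t ^+ 2 *: (P i *m W).
  by rewrite -scaler_sumr -mulmx_suml P1 mul1mx.
apply: loewner_sum => i v; have := GW i v; rewrite /qform !bformZ => h.
have g0 := psd_qform v (pG i); have w0 := psd_qform v (psd_PW i); have ti := blocktr_ge0 i.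
apply: le_trans (ler_wpM2l ti h) _; rewrite mulrA -expr2.
by apply: ler_wpM2r => //; rewrite ler_sqr ?nnegrE.
Qed.

Let V1 : loewner 1%:M (l *: V). Proof. exact: loewner_inv. Qed.

(** From [1 <= l V] one gets [D^T D <= l V K V]; then [K <= t^2 W] leaves [l t^2 V], and [V <= kap].
    Passing to [W] and back costs exactly the condition number of [W]. *)
Lemma loewner_blockdiag_hat t : 0 <= t -> (forall i, tau i <= t) ->
  loewner (D^T *m D) ((l * kap * t ^+ 2) *: 1%:M).
Proof.
move=> t0 ht; have h1 := loewner_congr D V1.
rewrite mulmx1 -scalemxAr -scalemxAl in h1; apply: loewner_trans h1 _.
have -> : (l * kap * t ^+ 2) *: 1%:M = l *: (t ^+ 2 *: (kap *: 1%:M)) :> 'M[R]_N.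
  by rewrite !scalerA mulrAC.
apply: loewnerZ => //; have -> : D^T *m V *m D = V^T *m K *m V.
  by rewrite DE trmx_mul Vs (proj1 pGG) /K !mulmxA.
apply: loewner_trans (loewner_congr V (KW t0 ht)) _.
rewrite -scalemxAr -scalemxAl Vs /V mulVmx// mul1mx.
by apply: loewnerZ => //; exact: exprn_ge0.
Qed.

Let trKV : \tr (K *m V) <= \sum_i tau i ^+ 2.
Proof.
rewrite mxtrace_mulC; apply: le_trans (loewner_mxtraceM pV KG) _.
rewrite mulmx_sumr raddf_sum /=; apply: ler_sum => i _.
by rewrite -scalemxAr mxtraceZ mxtrace_mulC -tauE expr2.
Qed.

Let trK : \tr K <= l * \sum_i tau i ^+ 2.
Proof.
have := loewner_mxtraceM pK V1; rewrite mulmx1 -scalemxAr mxtraceZ => h.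
by apply: le_trans h _; apply: ler_wpM2l => //; exact: trKV.
Qed.

(** [D S D^T <= s D W D^T = s K], and inserting [1 <= l V] reduces [tr K] to [tr (K V)], which the
    sandwich bound makes a sum of squared block traces. *)
Lemma mxtrace_blockdiag_hat_cov : \tr (D *m S *m D^T) <= s * l * \sum_i tau i ^+ 2.
Proof.
have := loewner_trmx (loewner_congr D^T Ss).
rewrite trmxK -scalemxAr -scalemxAl mxtraceZ => h; apply: le_trans h _.
have -> : D *m W *m D^T = K.
  by rewrite DE trmx_mul Vs (proj1 pGG) /K -!mulmxA [V *m (W *m _)]mulmxA mulVmx// mul1mx.
by rewrite -mulrA; apply: ler_wpM2l => //; exact: trK.
Qed.

(* The square of [D] is not symmetric: [D D = K W^-1] with [K] psd, and the
   form [v^T K W^-1 v] is split by AM-GM with the weight [l]. *)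
Definition blockdiag_hat_majorant : 'M[R]_N :=
  2^-1 *: (l^-1 *: K + l *: (V *m K *m V)).

Lemma qform_blockdiag_hat2 v : 0 < l ->
  `|qform (D *m D) v| <= qform blockdiag_hat_majorant v.
Proof.
move=> lp; have -> : qform (D *m D) v = bform K v (V *m v).
  by rewrite DE /qform /bform /K !mulmxA.
have c : bform K v (V *m v) = bform K (V *m v) v by rewrite bformC (proj1 pK).
have sq : qform (V *m K *m V) v = qform K (V *m v) by rewrite qform_congr Vs.
rewrite /blockdiag_hat_majorant /qform bformZ bformD !bformZ -!/(qform _ _) sq.
set p := qform K v; set q := qform K (V *m v); set b := bform K v (V *m v) in c *.
have h (e : R) : e = 1 \/ e = -1 -> 0 <= l^-1 * p + e * b *+ 2 + l * q.
  move=> he; have := psd_qform (v + (e * l) *: (V *m v)) pK.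
  rewrite /qform bformDl !bformDr !bformZl !bformZr -!/(qform _ _) -/p -/q -c -/b => h.
  have -> : l^-1 * p + e * b *+ 2 + l * q = l^-1 * (p + e * l * b + (e * l * b + e * l * (e * l * q))).
    by case: he => ->; rewrite mulr2n; field; rewrite gt_eqF.
  by rewrite mulr_ge0// invr_ge0 ltW.
have h1 := h 1 (or_introl erefl); have h2 := h (-1) (or_intror erefl).
by rewrite ler_norml; apply/andP; split; rewrite mulr2n in h1 h2; lra.
Qed.

(** The AM-GM weight [l] balances the two halves: [tr (K S)] is larger than [tr (V K V S)] by a
    factor [l^2] in the available bounds, so after weighting by [l^-1] and [l] both are at most
    [s l] times the sum. *)
Lemma mxtrace_blockdiag_hat_majorant : 0 < l ->
  \tr (blockdiag_hat_majorant *m S) <= s * l * \sum_i tau i ^+ 2.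
Proof.
move=> lp; set T := \sum_i _.
have t1 : \tr (K *m S) <= s * l * (l * T).
  apply: le_trans (loewner_mxtraceM pK loewner_cov_le) _.
  by rewrite -scalemxAr mulmx1 mxtraceZ; apply: ler_wpM2l; [exact: mulr_ge0|exact: trK].
have t2 : \tr (V *m K *m V *m S) <= s * T.
  have pVKV : possemidef (V *m K *m V) by rewrite -{1}Vs; exact: psd_congr.
  apply: le_trans (loewner_mxtraceM pVKV Ss) _; rewrite -scalemxAr mxtraceZ.
  apply: ler_wpM2l => //; rewrite mulmxKV// mxtrace_mulC; exact: trKV.
rewrite /blockdiag_hat_majorant -scalemxAl mxtraceZ mulmxDl -!scalemxAl mxtraceD !mxtraceZ.
have -> : s * l * T = 2^-1 * (l^-1 * (s * l * (l * T)) + l * (s * T)).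
  by field; rewrite gt_eqF.
rewrite ler_pM2l ?invr_gt0//; apply: lerD; first by rewrite ler_pM2l// invr_gt0.
exact: ler_wpM2l.
Qed.

(** After [S <= s W] and [A^T A <= l A^T V A], the identity [W A^T V A = A A] produces the diagonal
    block of [A^2], whose trace is that of [C_ii]. *)
Lemma mxtrace_block_gram i :
  \tr (P i *m (A^T *m A) *m P i *m S) <= s * l * \tr (P i *m (A *m A)).
Proof.
have pB : possemidef (P i *m (A^T *m A) *m P i).
  by rewrite -{1}Ps; apply: psd_congr; exact: psd_gram.
apply: le_trans (loewner_mxtraceM pB Ss) _; rewrite -scalemxAr mxtraceZ -mulrA.
apply: ler_wpM2l => //.
have -> : \tr (P i *m (A^T *m A) *m P i *m W) = \tr (P i *m W *m (A^T *m A)).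
  move: (A^T *m A) => B; rewrite -mulmxA PW mulmxA mxtrace_mulC !mulmxA PP.
  by rewrite [LHS]mxtrace_mulC !mulmxA.
have h := loewner_congr A V1; rewrite mulmx1 -scalemxAr -scalemxAl in h.
apply: le_trans (loewner_mxtraceM (psd_PW i) h) _.
rewrite -scalemxAr mxtraceZ; apply: ler_wpM2l => //.
rewrite le_eqVlt; apply/orP; left; apply/eqP.
rewrite -[RHS]mxtrace_tr [(P i *m _)^T]trmx_mul [(A *m A)^T]trmx_mul Ps [RHS]mxtrace_mulC.
rewrite trA AE -/V -!mulmxA [W *m (V *m _)]mulmxA mulmxV// mul1mx.
by rewrite [P i *m (V *m _)]mulmxA PV -[V *m P i *m _]mulmxA [RHS]mxtrace_mulC -!mulmxA.
Qed.

End HatBounds.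

(** * Expectation and independence *)

Section Expectation.
Local Open Scope classical_set_scope.
Local Open Scope ring_scope.
Context {d} {T : measurableType d} {R : realType} (P : probability T R).
Implicit Types f g : T -> R.

Definition L1 f := P.-integrable setT (EFin \o f).
Definition L2 f := measurable_fun setT f /\ L1 (fun w => f w ^+ 2).
(* [Ex f] is the junk value 0 when the expectation is infinite. *)
Definition Ex f : R := fine 'E_P[f]%E.

Lemma L1_measurable f : L1 f -> measurable_fun setT f.
Proof. by move=> /measurable_int /measurable_EFinP. Qed.

Lemma ExE f : L1 f -> ('E_P[f] = (Ex f)%:E)%E.
Proof. by move=> Lf; rewrite fineK// unlock integrable_fin_num. Qed.

Lemma L1_cst (c : R) : L1 (fun=> c).
Proof. exact: (finite_measure_integrable_cst P c). Qed.

Lemma L1D f g : L1 f -> L1 g -> L1 (fun w => f w + g w).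
Proof. by move=> Lf Lg; apply: eq_integrable (integrableD measurableT Lf Lg). Qed.

Lemma L1Z c f : L1 f -> L1 (fun w => c * f w).
Proof. by move=> Lf; apply: eq_integrable (integrableZl measurableT c Lf). Qed.

Lemma L1B f g : L1 f -> L1 g -> L1 (fun w => f w - g w).
Proof. by move=> Lf Lg; apply: eq_integrable (integrableB measurableT Lf Lg). Qed.

Lemma L1_sum (I : Type) (r : seq I) (F : I -> T -> R) : (forall i, L1 (F i)) ->
  L1 (fun w => \sum_(i <- r) F i w).
Proof.
move=> LF; elim: r => [|i r IH].
  by under [X in L1 X]eq_fun do rewrite big_nil; exact: L1_cst.
by under [X in L1 X]eq_fun do rewrite big_cons; exact: L1D.
Qed.

Lemma L1_dom f g : measurable_fun setT f -> L1 g -> (forall w, `|f w| <= g w) -> L1 f.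
Proof.
move=> mf Lg fg; apply: le_integrable Lg => //; first exact/measurable_EFinP.
by move=> w _ /=; rewrite lee_fin (le_trans (fg w))// ler_norm.
Qed.

Lemma Ex_cst (c : R) : Ex (fun=> c) = c.
Proof. by rewrite /Ex (_ : (fun=> c) = cst c)// expectation_cst. Qed.

Lemma ExD f g : L1 f -> L1 g -> Ex (fun w => f w + g w) = Ex f + Ex g.
Proof.
move=> Lf Lg; apply: EFin_inj; rewrite EFinD -!ExE//; last exact: L1D.
by rewrite unlock -integralD_EFin.
Qed.

Lemma ExZ c f : L1 f -> Ex (fun w => c * f w) = c * Ex f.
Proof.
move=> Lf; apply: EFin_inj; rewrite EFinM -!ExE//; last exact: L1Z.
by rewrite unlock -integralZl.
Qed.

Lemma ExB f g : L1 f -> L1 g -> Ex (fun w => f w - g w) = Ex f - Ex g.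
Proof.
move=> Lf Lg; under [X in Ex X]eq_fun do rewrite -mulN1r.
by rewrite ExD//; [rewrite ExZ// mulN1r|exact: L1Z].
Qed.

Lemma Ex_sum (I : Type) (r : seq I) (F : I -> T -> R) : (forall i, L1 (F i)) ->
  Ex (fun w => \sum_(i <- r) F i w) = \sum_(i <- r) Ex (F i).
Proof.
move=> LF; elim: r => [|i r IH].
  by under [X in Ex X]eq_fun do rewrite big_nil; rewrite Ex_cst big_nil.
under [X in Ex X]eq_fun do rewrite big_cons.
by rewrite ExD ?big_cons ?IH//; exact: L1_sum.
Qed.

Lemma Ex_ge0 f : (forall w, 0 <= f w) -> 0 <= Ex f.
Proof. by move=> f0; rewrite fine_ge0// expectation_ge0. Qed.

Lemma L2_cst (c : R) : L2 (fun=> c).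
Proof. by split; [exact: measurable_cst|exact: L1_cst]. Qed.

Lemma L2M f g : L2 f -> L2 g -> L1 (fun w => f w * g w).
Proof.
move=> [mf Lf] [mg Lg]; apply: (L1_dom _ (L1D Lf Lg)) => [|w].
  exact: measurable_funM.
rewrite ler_norml; apply/andP; split.
- by have := sqr_ge0 (f w + g w); have := sqr_ge0 (f w - g w); nra.
- by have := sqr_ge0 (f w + g w); have := sqr_ge0 (f w - g w); nra.
Qed.

Lemma L2_L1 f : L2 f -> L1 f.
Proof.
move=> Lf; have := L2M Lf (L2_cst 1).
by under [X in L1 X]eq_fun do rewrite mulr1.
Qed.

Lemma L2D f g : L2 f -> L2 g -> L2 (fun w => f w + g w).
Proof.
move=> Lf Lg; split; first by apply: measurable_funD; [case: Lf|case: Lg].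
under [X in L1 X]eq_fun do rewrite sqrrD mulr2n.
by apply: L1D (proj2 Lg); apply: L1D (proj2 Lf) _; apply: L1D; exact: L2M.
Qed.

Lemma L2Z c f : L2 f -> L2 (fun w => c * f w).
Proof.
move=> [mf Lf]; split; first exact: measurable_funM.
by under [X in L1 X]eq_fun do rewrite exprMn; exact: L1Z.
Qed.

Lemma L2_sum (I : Type) (r : seq I) (F : I -> T -> R) : (forall i, L2 (F i)) ->
  L2 (fun w => \sum_(i <- r) F i w).
Proof.
move=> LF; elim: r => [|i r IH].
  by under [X in L2 X]eq_fun do rewrite big_nil; exact: L2_cst.
by under [X in L2 X]eq_fun do rewrite big_cons; exact: L2D.
Qed.

Lemma L2_dom f g : measurable_fun setT f -> L2 g -> (forall w, `|f w| <= g w) -> L2 f.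
Proof.
move=> mf Lg fg; split => //; apply: L1_dom (proj2 Lg) _; first exact: measurable_funX.
move=> w; rewrite normrX lerXn2r ?nnegrE//; exact: le_trans (normr_ge0 _) (fg w).
Qed.

Lemma Ex_CauchySchwarz f g : L2 f -> L2 g ->
  Ex (fun w => f w * g w) ^+ 2 <= Ex (fun w => f w ^+ 2) * Ex (fun w => g w ^+ 2).
Proof.
move=> Lf Lg; set a := Ex _; set b := Ex _; set c := Ex _.
have h t u : 0 <= t ^+ 2 * b + 2 * (t * u) * a + u ^+ 2 * c.
  rewrite /a /b /c -!ExZ; [|exact: (proj2 Lg)|exact: L2M|exact: (proj2 Lf)].
  rewrite -!ExD.
  - apply: Ex_ge0 => w; apply: le_trans (sqr_ge0 (t * f w + u * g w)) _.
    by rewrite le_eqVlt; apply/orP; left; apply/eqP; ring.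
  - by apply: L1D; apply: L1Z; [exact: (proj2 Lf)|exact: L2M].
  - by apply: L1Z; exact: (proj2 Lg).
  - by apply: L1Z; exact: (proj2 Lf).
  - by apply: L1Z; exact: L2M.
have b0 : 0 <= b by apply: Ex_ge0 => w; exact: sqr_ge0.
have c0 : 0 <= c by apply: Ex_ge0 => w; exact: sqr_ge0.
have [cz|cz] := eqVneq c 0.
  have [->|az] := eqVneq a 0; first by rewrite expr0n mulr_ge0.
  (* With [c = 0] the form is affine in [u]; this value of [u] makes it [- b - 2], which is
     negative. *)
  have := h 1 (- (b + 1) / a); rewrite cz mulr0 addr0 expr1n !mul1r.
  have -> : 2 * (- (b + 1) / a) * a = - 2 * (b + 1) by field.
  by move=> ?; exfalso; lra.
have cp : 0 < c by rewrite lt_neqAle eq_sym cz.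
have h1 := h c (- a); rewrite -subr_ge0 -(pmulr_rge0 _ cp).
by apply: le_trans h1 _; rewrite le_eqVlt; apply/orP; left; apply/eqP; ring.
Qed.

Lemma measurable_lt_set f g : measurable_fun setT f -> measurable_fun setT g ->
  measurable [set w | f w < g w].
Proof.
move=> mf mg; have := measurable_fun_ltr mf mg.
by move=> /(_ measurableT [set true]); rewrite setTI; exact.
Qed.

Lemma measurable_le_set f g : measurable_fun setT f -> measurable_fun setT g ->
  measurable [set w | f w <= g w].
Proof.
move=> mf mg; have := measurable_fun_ler mf mg.
by move=> /(_ measurableT [set true]); rewrite setTI; exact.
Qed.

Lemma Ex_markov f (c : R) : measurable_fun setT f -> 0 < c -> L1 f -> (forall w, 0 <= f w) ->
  (P [set w | (c <= f w)%R] <= (Ex f / c)%:E)%E.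
Proof.
move=> mf c0 Lf f0.
pose X : {RV P >-> R} := HB.pack f (isMeasurableFun.Build _ _ _ _ f mf).
have := @markov _ _ _ P X idfun c c0 (@measurable_id _ _ _) (fun r h => h) (fun _ _ _ _ h => h).
have -> : (idfun \o (fun x => `|x|) \o X = f)%R.
  by apply/funext => w /=; rewrite ger0_norm.
rewrite /= (_ : [set x | (c%:E <= `|f x|%:E)%E] = [set w | (c <= f w)%R]); last first.
  by apply/seteqP; split=> w /=; rewrite lee_fin ger0_norm.
rewrite ExE// EFinM => h; rewrite lee_pdivlMr// muleC; exact: h.
Qed.

End Expectation.

(** * Factorisation of expectations over independent subjects *)

Section Independence.
Local Open Scope classical_set_scope.
Local Open Scope ring_scope.
Context {d} {T : measurableType d} {R : realType} (P : probability T R).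

Definition indep_fun (X Z : T -> R) : Prop := forall A B : set R,
  measurable A -> measurable B -> P (X @^-1` A `&` Z @^-1` B) = (P (X @^-1` A) * P (Z @^-1` B))%E.

(** The joint law agrees with the product of the marginal laws on rectangles, hence everywhere, and
    Fubini splits the integral of the product. *)
Lemma RV_Ex_indepM (X Z : {RV P >-> R}) : indep_fun X Z -> L1 P X -> L1 P Z ->
  L1 P (fun w => X w * Z w) -> Ex P (fun w => X w * Z w) = Ex P X * Ex P Z.
Proof.
move=> XZ LX LZ LXZ.
pose m1 : probability R R := distribution P X; pose m2 : probability R R := distribution P Z.
pose XZf := fun w => (X w, Z w).
have mXZ : measurable_fun setT XZf by exact: measurable_fun_pair.
pose XZr : {mfun T >-> (R * R)%type} := HB.pack XZf (isMeasurableFun.Build _ _ _ _ XZf mXZ).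
pose m' : probability (R * R)%type R := distribution P XZr.
pose h (z : R * R) : \bar R := (z.1 * z.2)%:E.
have mh : measurable_fun setT h by apply/measurable_EFinP; exact: measurable_funM.
have E : forall A, measurable A -> (m1 \x m2)%E A = m' A.
  apply: product_measure_unique => A B mA mB.
  by rewrite /m' /distribution /pushforward -XZ.
have ih' : m'.-integrable setT h by apply: integrable_pushforward.
have ih : (m1 \x m2)%E.-integrable setT h.
  apply/integrableP; split => //; move/integrableP: ih' => [_].
  by congr (_ < _)%E; apply/esym/eq_measure_integral => A mA _; exact: E.
have e1 : (\int[P]_w (X w * Z w)%:E = \int[(m1 \x m2)%E]_z h z)%E.
  rewrite (eq_measure_integral m') => [|A mA _]; last exact: E.
  by rewrite integral_pushforward.
apply: EFin_inj; rewrite EFinM -!ExE// unlock e1 -integral12_prod_meas1//.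
rewrite /fubini_F /h /=.
have iZ : m2.-integrable setT (EFin) by apply: integrable_pushforward.
have iX : m1.-integrable setT (EFin) by apply: integrable_pushforward.
under eq_integral do [under eq_integral do rewrite EFinM]; rewrite /=.
under eq_integral do rewrite integralZl//.
have -> : (\int[P]_w (Z w)%:E = \int[m2]_z z%:E)%E by rewrite integral_pushforward.
have -> : (\int[P]_w (X w)%:E = \int[m1]_z z%:E)%E by rewrite integral_pushforward.
have /fineK <- : (\int[m2]_z z%:E)%E \is a fin_num by exact: integrable_fin_num.
by rewrite integralZr.
Qed.

Lemma Ex_indepM (X Z : T -> R) : indep_fun X Z -> L1 P X -> L1 P Z ->
  L1 P (fun w => X w * Z w) -> Ex P (fun w => X w * Z w) = Ex P X * Ex P Z.
Proof.
move=> XZ LX LZ.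
pose X' : {RV P >-> R} := HB.pack X (isMeasurableFun.Build _ _ _ _ X (L1_measurable LX)).
pose Z' : {RV P >-> R} := HB.pack Z (isMeasurableFun.Build _ _ _ _ Z (L1_measurable LZ)).
exact: (@RV_Ex_indepM X' Z').
Qed.

Definition subsigma_fun (G : set (set T)) (X : T -> R) :=
  @measurable_fun _ _ (g_sigma_algebraType G) R setT X.

Lemma subsigma_preimage (G : set (set T)) X (A : set R) : subsigma_fun G X -> measurable A ->
  <<s G >> (X @^-1` A).
Proof. by move=> mX mA; have := mX measurableT _ mA; rewrite setTI. Qed.

Lemma subsigma_fun_gen (G : set (set T)) X : (forall A : set R, measurable A -> <<s G >> (X @^-1` A)) ->
  subsigma_fun G X.
Proof. by move=> h _ A mA; rewrite setTI; exact: h. Qed.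

Context {n : nat} {k : 'I_n -> nat} (y : forall i : 'I_n, 'I_(k i) -> {RV P >-> R}).
Context (indep : independent_vectors y).

Definition block_gen (i : 'I_n) : set (set T) :=
  \big[setU/set0]_(j < k i) preimage_set_system setT (y j : T -> R) measurable.

(** Intersections of one event per other subject generate the same information as the individual
    events, form a pi-system, and are sets to which mutual independence applies directly. *)
Definition others_gen (i : 'I_n) : set (set T) :=
  [set B | exists2 E : 'I_n -> set T, (forall j, <<s block_gen j >> (E j)) &
     B = \bigcap_(j in [set` ~: [set i]%SET]) E j].

Lemma block_gen_measurable i : <<s block_gen i >> `<=` measurable.
Proof.
apply: smallest_sub; first exact: sigma_algebra_measurable.
rewrite /block_gen; elim/big_ind : _ => // [A B hA hB C [/hA|/hB]//|j _ _ [A mA <-]].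
by rewrite setTI; exact: measurable_funPTI.
Qed.

Lemma others_gen_measurable i : others_gen i `<=` measurable.
Proof.
move=> _ [E hE ->]; apply: fin_bigcap_measurable => [|j _]; first exact: finite_finset.
by apply: (@block_gen_measurable j).
Qed.

Lemma block_gen_fun i (j : 'I_(k i)) : subsigma_fun (block_gen i) (y j).
Proof.
apply: subsigma_fun_gen => A mA; apply: sub_sigma_algebra.
by rewrite /block_gen (bigD1 j)//=; left; exists A => //; rewrite setTI.
Qed.

Lemma others_gen_fun i i' (j : 'I_(k i')) : i' != i -> subsigma_fun (others_gen i) (y j).
Proof.
move=> ii'; apply: subsigma_fun_gen => A mA; apply: sub_sigma_algebra.
exists (fun l => if l == i' then y j @^-1` A else setT).
  move=> l; case: eqP => [->|_]; last exact: (@measurableT _ (g_sigma_algebraType _)).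
  by apply: subsigma_preimage mA; exact: block_gen_fun.
apply/seteqP; split=> w /=; first by move=> h l _; case: eqP.
by move=> /(_ i'); rewrite eqxx; apply; rewrite /= !inE.
Qed.

(* [others_gen i] is stable under intersection, so it suffices to compare on it
   the two finite measures [C |-> P (B `&` C)] and [C |-> P B * P C]. *)
Lemma block_others_indep i (B C : set T) : <<s block_gen i >> B -> <<s others_gen i >> C ->
  P (B `&` C) = (P B * P C)%E.
Proof.
move=> hB; have mB := block_gen_measurable hB.
have PB0 : 0 <= fine (P B) by rewrite fine_ge0.
pose m1 := mrestr P mB; pose m2 := mscale (NngNum PB0) P.
suff : forall C, <<s others_gen i >> C -> m1 C = m2 C.
  move=> h /h; rewrite /m1 /m2 /mrestr /mscale /= setIC => ->.
  by rewrite fineK// fin_num_measure.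
apply: (@g_sigma_algebra_measure_unique _ _ _ _ (@others_gen_measurable i) (fun=> setT)).
- move=> _; exists (fun=> setT); last by rewrite bigcapT.
  by move=> j; exact: (@measurableT _ (g_sigma_algebraType _)).
- by rewrite bigcup_const.
- move=> _ _ [E hE ->] [F hF ->]; exists (fun j => E j `&` F j).
    by move=> j; exact: (@measurableI _ (g_sigma_algebraType (block_gen j)) _ _ (hE j) (hF j)).
  by rewrite bigcapI.
- move=> _ [E hE ->].
  (* The intersection over [j != i] does not see [E i], so [B] may be put there. Independence over
     all subjects and over the others then yields the same product up to the factor [P B]. *)
  pose E' j := if j == i then B else E j.
  have hE' j : <<s block_gen j >> (E' j) by rewrite /E'; case: eqP => [->|].
  have e1 := indep [set: 'I_n]%SET hE'; have e2 := indep (~: [set i])%SET hE'.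
  have E'E : \bigcap_(j in [set` (~: [set i])%SET]) E j = \bigcap_(j in [set` (~: [set i])%SET]) E' j.
    by apply: eq_bigcapr => j; rewrite /= !inE /E' => /negbTE ->.
  change (P (\bigcap_(j in [set` (~: [set i])%SET]) E j `&` B) =
    ((fine (P B))%:E * P (\bigcap_(j in [set` (~: [set i])%SET]) E j))%E).
  rewrite fineK ?fin_num_measure// E'E e2.
  have -> : \bigcap_(j in [set` (~: [set i])%SET]) E' j `&` B = \bigcap_(j in [set` [set: 'I_n]%SET]) E' j.
    apply/seteqP; split=> w.
      move=> [h Bw] j _; case: (eqVneq j i) => [->|ji]; first by rewrite /E' eqxx.
      by apply: h; rewrite /= !inE.
    move=> h; split; last by have := h i; rewrite /E' eqxx; apply; rewrite /= inE.
    by move=> j _; apply: h; rewrite /= inE.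
  rewrite e1 (bigD1 i) ?inE//= {1}/E' eqxx; congr (_ * _)%E.
  by apply: eq_bigl => j; rewrite !inE andbC andbT.
- move=> _; change (P (setT `&` B) < +oo)%E.
  by rewrite setTI (le_lt_trans (probability_le1 _ _)) ?ltry.
Qed.

Lemma Ex_block_othersM i (X Z : T -> R) :
  subsigma_fun (block_gen i) X -> subsigma_fun (others_gen i) Z ->
  L1 P X -> L1 P Z -> L1 P (fun w => X w * Z w) -> Ex P (fun w => X w * Z w) = Ex P X * Ex P Z.
Proof.
move=> mX mZ; apply: Ex_indepM => A B mA mB.
by apply: (@block_others_indep i); exact: subsigma_preimage.
Qed.

End Independence.

(** * Moments of quadratic forms in the noise *)

Section SubsigmaFun.
Local Open Scope classical_set_scope.
Local Open Scope ring_scope.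
Context {d} {T : measurableType d} {R : realType} (G : set (set T)).

Lemma subsigma_fun_cst (c : R) : subsigma_fun G (fun=> c).
Proof. exact: measurable_cst. Qed.

Lemma subsigma_funD (X Y : T -> R) : subsigma_fun G X -> subsigma_fun G Y ->
  subsigma_fun G (fun w => X w + Y w).
Proof. exact: measurable_funD. Qed.

Lemma subsigma_funM (X Y : T -> R) : subsigma_fun G X -> subsigma_fun G Y ->
  subsigma_fun G (fun w => X w * Y w).
Proof. exact: measurable_funM. Qed.

Lemma subsigma_fun_sum (I : Type) (r : seq I) (F : I -> T -> R) :
  (forall i, subsigma_fun G (F i)) -> subsigma_fun G (fun w => \sum_(i <- r) F i w).
Proof.
move=> hF; elim: r => [|i r IH].
  by under [X in subsigma_fun _ X]eq_fun do rewrite big_nil; exact: subsigma_fun_cst.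
by under [X in subsigma_fun _ X]eq_fun do rewrite big_cons; exact: subsigma_funD.
Qed.

End SubsigmaFun.

(** * Block structure by coordinate projections *)

Section BlockMask.
Local Open Scope classical_set_scope.
Local Open Scope ring_scope.
Context {R : realType} {n N : nat} (blk : 'I_N -> 'I_n).

(** Blocks are cut out by 0/1 diagonal projections of the full size, so that block arguments become
    identities between square matrices of one type. *)
Definition blkmask i : 'M[R]_N := diag_mx (\row_a (blk a == i)%:R).

Lemma blkmaskMl i (B : 'M[R]_N) a b : (blkmask i *m B) a b = (blk a == i)%:R * B a b.
Proof. by rewrite mul_diag_mx !mxE. Qed.

Lemma blkmaskMr i (B : 'M[R]_N) a b : (B *m blkmask i) a b = B a b * (blk b == i)%:R.
Proof. by rewrite mul_mx_diag !mxE. Qed.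

Lemma blkmask_tr i : (blkmask i)^T = blkmask i.
Proof. exact: tr_diag_mx. Qed.

Lemma blkmask_idem i : blkmask i *m blkmask i = blkmask i.
Proof.
apply/matrixP => a b; rewrite blkmaskMl !mxE.
by case: (blk a == i); rewrite ?mul1r// mul0r mul0rn.
Qed.

Lemma blkmask_disj i j : i != j -> blkmask i *m blkmask j = 0.
Proof.
move=> ij; apply/matrixP => a b; rewrite blkmaskMl !mxE.
case: eqP => [->|_]; last by rewrite mul0r.
by rewrite (negbTE ij) mul0rn mulr0.
Qed.

Lemma blkmask_sum : \sum_i blkmask i = 1%:M.
Proof.
apply/matrixP => a b; rewrite summxE !mxE (bigD1 (blk a))//= big1 ?addr0.
  by rewrite !mxE eqxx.
by move=> i /negbTE ia; rewrite !mxE eq_sym ia mul0rn.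
Qed.

Definition blockdiag_mx (B : 'M[R]_N) : Prop := forall a b, blk a != blk b -> B a b = 0.

Lemma blkmask_comm i (B : 'M[R]_N) : blockdiag_mx B -> blkmask i *m B = B *m blkmask i.
Proof.
move=> hB; apply/matrixP => a b; rewrite blkmaskMl blkmaskMr.
case: (eqVneq (blk a) (blk b)) => [->|/hB ->]; first by rewrite mulrC.
by rewrite mul0r mulr0.
Qed.

Definition offdiag (B : 'M[R]_N) : 'M[R]_N := \matrix_(a, b) if blk a == blk b then 0 else B a b.

Lemma offdiagE (B : 'M[R]_N) : offdiag B = B - \sum_i blkmask i *m B *m blkmask i.
Proof.
apply/matrixP => a b; rewrite !mxE summxE (bigD1 (blk a))//= big1 ?addr0.
  rewrite blkmaskMr blkmaskMl eqxx mul1r [blk b == _]eq_sym.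
  by case: eqP => _; rewrite ?mulr1 ?subrr// mulr0 subr0.
by move=> i /negbTE ia; rewrite blkmaskMr blkmaskMl eq_sym ia !mul0r.
Qed.

End BlockMask.

(** * The trace form attached to the covariance *)

Section TraceForms.
Local Open Scope classical_set_scope.
Local Open Scope ring_scope.
Context {R : realType} {n N : nat} (blk : 'I_N -> 'I_n) (S : 'M[R]_N).
Context (pS : possemidef S) (bS : blockdiag_mx blk S).

Let Ss : S^T = S := proj1 pS.

(** This is the Frobenius inner product of [S^{1/2} B S^{1/2}] and [S^{1/2} C S^{1/2}]. *)
Let trform (B C : 'M[R]_N) : R := \tr (B *m S *m C^T *m S).

Let trformDl B1 B2 C : trform (B1 + B2) C = trform B1 C + trform B2 C.
Proof. by rewrite /trform !mulmxDl mxtraceD. Qed.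

Let trformC B C : trform B C = trform C B.
Proof.
rewrite /trform -[LHS]mxtrace_tr !trmx_mul !trmxK Ss.
by rewrite [LHS]mxtrace_mulC -!mulmxA.
Qed.

Let trform_ge0 B : 0 <= trform B B.
Proof.
rewrite /trform; apply: mxtraceM_ge0 => //.
by rewrite -{1}[B]trmxK; exact: psd_congr.
Qed.

Let trformT B C : trform B^T C^T = trform B C.
Proof.
rewrite /trform trmxK -[LHS]mxtrace_tr !trmx_mul trmxK Ss.
by rewrite !mulmxA [LHS]mxtrace_mulC !mulmxA.
Qed.

(** Transposition preserves the trace form, so expanding the square of [B - B^T] compares the
    product of [B] and [B^T] with the square of [B]. *)
Lemma mxtrace_form_sym_le B : \tr (B *m S *m B *m S) <= \tr (B *m S *m B^T *m S).
Proof.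
have DlN B1 B2 C : trform (B1 - B2) C = trform B1 C - trform B2 C.
  by rewrite /trform !mulmxBl raddfB.
have := trform_ge0 (B - B^T).
rewrite DlN (trformC B (B - B^T)) (trformC B^T (B - B^T)) !DlN trformT (trformC B^T B).
have -> : trform B B^T = \tr (B *m S *m B *m S) by rewrite /trform trmxK.
by rewrite /trform; lra.
Qed.

(** Since [S] is block diagonal, the diagonal and off-diagonal parts of [B] are orthogonal for the
    trace form, and Pythagoras applies. *)
Lemma mxtrace_offdiag_le B :
  \tr (offdiag blk B *m S *m (offdiag blk B)^T *m S) <= \tr (B *m S *m B^T *m S).
Proof.
set B0 := offdiag blk B; pose Bd := B - B0.
have BE : B = B0 + Bd by rewrite /Bd addrC subrK.
have cross : trform B0 Bd = 0.
  rewrite /trform /mxtrace big1// => a _; rewrite mxE big1// => c _.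
  have [ca|ca] := eqVneq (blk c) (blk a); last by rewrite [S c a]bS// mulr0.
  rewrite mxE big1 ?mul0r// => d _; rewrite [Bd^T d c]mxE.
  rewrite mxE; have [dc|dc] := eqVneq (blk d) (blk c); last first.
    have -> : Bd c d = 0 by rewrite !mxE eq_sym (negbTE dc) subrr.
    by rewrite mulr0.
  rewrite big1 ?mul0r// => b _.
  have [bd|bd] := eqVneq (blk b) (blk d); last by rewrite [S b d]bS// mulr0.
  by rewrite mxE bd dc ca eqxx mul0r.
have h X Y : trform X Y = 0 -> trform (X + Y) (X + Y) = trform X X + trform Y Y.
  move=> XY; rewrite trformDl (trformC X (X + Y)) (trformC Y (X + Y)) !trformDl.
  by rewrite (trformC Y X) XY addr0 add0r.
have := h B0 Bd cross; rewrite -BE => e.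
by rewrite -/(trform B0 B0) -/(trform B B) e lerDl.
Qed.

(** The two expansions name their indices so that, with [C a b * C c d] as common coefficient, they
    match the two pairings of four noise coordinates. *)
Lemma mxtrace4 (A B C D : 'M[R]_N) : \tr (A *m B *m C *m D) =
  \sum_a \sum_b \sum_c \sum_d A a b * B b d * C d c * D c a.
Proof.
rewrite /mxtrace; apply: eq_bigr => a _; rewrite mxE exchange_big /=.
apply: eq_bigr => c _; rewrite !mxE mulr_suml exchange_big /=; apply: eq_bigr => d _.
rewrite !mxE !mulr_suml; apply: eq_bigr => b _; by [].
Qed.

Lemma mxtrace4r (A B C D : 'M[R]_N) : \tr (A *m B *m C *m D) =
  \sum_a \sum_b \sum_c \sum_d A a b * B b c * C c d * D d a.
Proof.
rewrite mxtrace4; apply: eq_bigr => a _; apply: eq_bigr => b _.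
by rewrite exchange_big.
Qed.

End TraceForms.

(** * Second and fourth moments of the noise *)

Section NoiseMoments.
Local Open Scope classical_set_scope.
Local Open Scope ring_scope.
Context {d} {T : measurableType d} {R : realType} {P : probability T R}.
Context {n N : nat} {k : 'I_n -> nat} {y : forall i : 'I_n, 'I_(k i) -> {RV P >-> R}}
  (indep : independent_vectors y).
Context {blk : 'I_N -> 'I_n} {S : 'M[R]_N} {e : 'I_N -> T -> R}.
Context (pS : possemidef S) (bS : blockdiag_mx blk S)
  (e_block : forall a, subsigma_fun (block_gen y (blk a)) (e a))
  (e_others : forall a i, blk a != i -> subsigma_fun (others_gen y i) (e a))
  (em : forall a, measurable_fun setT (e a))
  (e4 : forall a, L2 P (fun w => e a w ^+ 2))
  (e0 : forall a, Ex P (e a) = 0)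
  (eS : forall a b, blk a = blk b -> Ex P (fun w => e a w * e b w) = S a b).

Lemma noise_mul_L2 a b : L2 P (fun w => e a w * e b w).
Proof.
apply: (L2_dom _ (L2D (e4 a) (e4 b))) => [|w]; first exact: measurable_funM.
rewrite ler_norml; apply/andP; split.
- by have := sqr_ge0 (e a w + e b w); nra.
- by have := sqr_ge0 (e a w - e b w); nra.
Qed.

Lemma noise_L2 a : L2 P (e a).
Proof. by split => //; apply: L2_L1. Qed.

Lemma noise_mul4_L1 a b c d' : L1 P (fun w => (e a w * e b w) * (e c w * e d' w)).
Proof. by apply: L2M; exact: noise_mul_L2. Qed.

Lemma noise_cov a b : Ex P (fun w => e a w * e b w) = S a b.
Proof.
have [/eS//|ab] := eqVneq (blk a) (blk b); rewrite bS//.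
rewrite (Ex_block_othersM indep (i := blk a))//.
- by rewrite e0 mul0r.
- by apply: e_others; rewrite eq_sym.
- exact/L2_L1/noise_L2.
- exact/L2_L1/noise_L2.
- exact/L2_L1/noise_mul_L2.
Qed.

Let alone a b c d' : blk b != blk a -> blk c != blk a -> blk d' != blk a ->
  Ex P (fun w => (e a w * e b w) * (e c w * e d' w)) = 0.
Proof.
move=> ba ca da.
under [X in Ex P X]eq_fun do rewrite -mulrA.
rewrite (Ex_block_othersM indep (i := blk a))//.
- by rewrite e0 mul0r.
- by apply: subsigma_funM; [|apply: subsigma_funM]; exact: e_others.
- exact/L2_L1/noise_L2.
- by apply: L2M; [exact: noise_L2|exact: noise_mul_L2].
- by under [X in L1 P X]eq_fun do rewrite mulrA; exact: noise_mul4_L1.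
Qed.

Let paired a b c d' : blk b = blk a -> blk c != blk a -> blk d' != blk a ->
  Ex P (fun w => (e a w * e b w) * (e c w * e d' w)) = S a b * S c d'.
Proof.
move=> ba ca da; rewrite (Ex_block_othersM indep (i := blk a)).
- by rewrite !noise_cov.
- by apply: subsigma_funM => //; rewrite -ba.
- by apply: subsigma_funM; exact: e_others.
- exact/L2_L1/noise_mul_L2.
- exact/L2_L1/noise_mul_L2.
- exact: noise_mul4_L1.
Qed.

(** A subject can own at most one of [a], [b] and one of [c], [d']. Either the four indices split
    into two pairs, or some index is alone with its subject and its zero mean factors out; no fourth
    moment within a subject arises. *)
Lemma noise_mul4 a b c d' : blk a != blk b -> blk c != blk d' ->
  Ex P (fun w => (e a w * e b w) * (e c w * e d' w)) = S a c * S b d' + S a d' * S b c.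
Proof.
move=> ab cd.
have [ca|ca] := eqVneq (blk c) (blk a).
  have da : blk d' != blk a by rewrite -ca eq_sym.
  rewrite [S a d']bS 1?eq_sym// mul0r addr0.
  under [X in Ex P X]eq_fun do rewrite mulrACA.
  have [db|db] := eqVneq (blk d') (blk b); first by rewrite paired// eq_sym.
  under [X in Ex P X]eq_fun => w do rewrite [_ * _ * _]mulrC [e b w * _]mulrC mulrC.
  under [X in Ex P X]eq_fun => w do rewrite [e d' w * _]mulrC mulrC.
  by rewrite alone// ?ca// [S b d']bS ?mulr0// eq_sym.
rewrite [S a c]bS 1?eq_sym// mul0r add0r.
have [da|da] := eqVneq (blk d') (blk a).
  under [X in Ex P X]eq_fun => w do rewrite [e c w * _]mulrC mulrACA.
  have [cb|cb] := eqVneq (blk c) (blk b); first by rewrite paired// eq_sym.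
  under [X in Ex P X]eq_fun => w do rewrite mulrC.
  by rewrite alone// ?da// [S b c]bS ?mulr0// eq_sym.
by rewrite alone// 1?eq_sym// [S a d']bS 1?eq_sym// mul0r.
Qed.

Definition noise_vec (w : T) : 'cV[R]_N := \col_a e a w.

Lemma qform_noiseE (B : 'M[R]_N) w :
  qform B (noise_vec w) = \sum_a \sum_b B a b * (e a w * e b w).
Proof.
rewrite /qform /bform !mxE exchange_big /=; apply: eq_bigr => b _.
rewrite !mxE mulr_suml; apply: eq_bigr => a _; rewrite !mxE; ring.
Qed.

Lemma qform_noise_L2 B : L2 P (fun w => qform B (noise_vec w)).
Proof.
under [X in L2 P X]eq_fun do rewrite qform_noiseE.
by apply: L2_sum => a; apply: L2_sum => b; apply: L2Z; exact: noise_mul_L2.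
Qed.

Lemma Ex_qform_noise B : Ex P (fun w => qform B (noise_vec w)) = \tr (B *m S).
Proof.
under [X in Ex P X]eq_fun do rewrite qform_noiseE.
rewrite Ex_sum => [|a]; last by apply: L1_sum => b; apply: L1Z; exact/L2_L1/noise_mul_L2.
apply: eq_bigr => a _; rewrite mxE Ex_sum => [|b]; last by apply: L1Z; exact/L2_L1/noise_mul_L2.
apply: eq_bigr => b _; rewrite ExZ; last exact/L2_L1/noise_mul_L2.
by rewrite noise_cov -[in RHS](proj1 pS) mxE.
Qed.

Lemma linear_noiseE (c : 'cV[R]_N) w :
  (c^T *m noise_vec w) 0 0 ^+ 2 = qform (c *m c^T) (noise_vec w).
Proof.
rewrite /qform /bform.
have -> : (noise_vec w)^T *m (c *m c^T) *m noise_vec w =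
    (c^T *m noise_vec w)^T *m (c^T *m noise_vec w) by rewrite trmx_mul trmxK !mulmxA.
by rewrite [RHS]mxE big_ord1 [X in _ = X * _]mxE expr2.
Qed.

Lemma linear_noise_L2 (c : 'cV[R]_N) : L2 P (fun w => (c^T *m noise_vec w) 0 0).
Proof.
under [X in L2 P X]eq_fun do rewrite mxE.
apply: L2_sum => a; under [X in L2 P X]eq_fun do rewrite !mxE.
by apply: L2Z; exact: noise_L2.
Qed.

Lemma Ex_linear_noise (c : 'cV[R]_N) : Ex P (fun w => (c^T *m noise_vec w) 0 0) = 0.
Proof.
under [X in Ex P X]eq_fun do rewrite mxE.
rewrite Ex_sum => [|a].
  rewrite big1// => a _; under [X in Ex P X]eq_fun do rewrite !mxE.
  by rewrite ExZ ?e0 ?mulr0//; exact/L2_L1/noise_L2.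
under [X in L1 P X]eq_fun do rewrite !mxE.
by apply: L1Z; exact/L2_L1/noise_L2.
Qed.

Lemma Ex_linear_noise2 (c : 'cV[R]_N) : Ex P (fun w => (c^T *m noise_vec w) 0 0 ^+ 2) = qform S c.
Proof.
under [X in Ex P X]eq_fun do rewrite linear_noiseE.
rewrite Ex_qform_noise -mulmxA mxtrace_mulC /mxtrace big_ord1.
by rewrite /qform /bform.
Qed.

(** Each of the two pairings contributes a trace; the non-symmetric one is dominated by the other,
    whence the factor 2. *)
Lemma Ex_offdiag_noise2 B : Ex P (fun w => qform (offdiag blk B) (noise_vec w) ^+ 2)
  <= 2 * \tr (B *m S *m B^T *m S).
Proof.
set C := offdiag blk B.
have CE : Ex P (fun w => qform C (noise_vec w) ^+ 2) =
    \tr (C *m S *m C^T *m S) + \tr (C *m S *m C *m S).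
  pose F a b c d' w := (C a b * C c d') * ((e a w * e b w) * (e c w * e d' w)).
  have LF a b c d' : L1 P (F a b c d') by apply: L1Z; exact: noise_mul4_L1.
  transitivity (Ex P (fun w => \sum_a \sum_b \sum_c \sum_d' F a b c d' w)).
    congr (Ex P _); apply/funext => w; rewrite expr2 {1}qform_noiseE mulr_suml.
    apply: eq_bigr => a _; rewrite mulr_suml; apply: eq_bigr => b _.
    rewrite qform_noiseE mulr_sumr; apply: eq_bigr => c _.
    by rewrite mulr_sumr; apply: eq_bigr => d' _; rewrite /F; ring.
  rewrite Ex_sum => [|a]; last by do 3![apply: L1_sum => ?].
  rewrite mxtrace4 mxtrace4r -big_split /=; apply: eq_bigr => a _.
  rewrite Ex_sum => [|b]; last by do 2![apply: L1_sum => ?].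
  rewrite -big_split /=; apply: eq_bigr => b _.
  rewrite Ex_sum => [|c]; last by apply: L1_sum => ?.
  rewrite -big_split /=; apply: eq_bigr => c _.
  rewrite Ex_sum => [|//]; rewrite -big_split /=; apply: eq_bigr => d' _.
  rewrite /F ExZ; last exact: noise_mul4_L1.
  have Sc u v : S u v = S v u by rewrite -[in LHS](proj1 pS) mxE.
  rewrite [C^T _ _]mxE; have [ab|ab] := eqVneq (blk a) (blk b).
    have -> : C a b = 0 by rewrite mxE ab eqxx.
    by rewrite !mul0r addr0.
  have [cd|cd] := eqVneq (blk c) (blk d').
    have -> : C c d' = 0 by rewrite mxE cd eqxx.
    by rewrite !(mulr0, mul0r) addr0.
  by rewrite noise_mul4// (Sc c a) (Sc d' a); ring.
rewrite CE mulr_natl mulr2n.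
have h1 := mxtrace_form_sym_le pS C; have h2 := mxtrace_offdiag_le pS bS B.
by apply: lerD; [exact: h2|exact: le_trans h1 h2].
Qed.

Let block_form_coef0 i (B : 'M[R]_N) a b : (blk a != i) || (blk b != i) ->
  (blkmask blk i *m B *m blkmask blk i) a b = 0.
Proof.
by rewrite blkmaskMr blkmaskMl => /orP[] /negbTE ->; rewrite ?mul0r// mulr0.
Qed.

Let block_form_block i B :
  subsigma_fun (block_gen y i) (fun w => qform (blkmask blk i *m B *m blkmask blk i) (noise_vec w)).
Proof.
under [X in subsigma_fun _ X]eq_fun do rewrite qform_noiseE.
apply: subsigma_fun_sum => a; apply: subsigma_fun_sum => b.
have [/block_form_coef0 ->|] := boolP ((blk a != i) || (blk b != i)).
  by under [X in subsigma_fun _ X]eq_fun do rewrite mul0r; exact: subsigma_fun_cst.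
rewrite negb_or !negbK => /andP[/eqP ai /eqP bi].
apply: subsigma_funM; first exact: subsigma_fun_cst.
by apply: subsigma_funM; [rewrite -ai|rewrite -bi].
Qed.

Let block_form_others i j B : j != i ->
  subsigma_fun (others_gen y i) (fun w => qform (blkmask blk j *m B *m blkmask blk j) (noise_vec w)).
Proof.
move=> ji; under [X in subsigma_fun _ X]eq_fun do rewrite qform_noiseE.
apply: subsigma_fun_sum => a; apply: subsigma_fun_sum => b.
have [/block_form_coef0 ->|] := boolP ((blk a != j) || (blk b != j)).
  by under [X in subsigma_fun _ X]eq_fun do rewrite mul0r; exact: subsigma_fun_cst.
rewrite negb_or !negbK => /andP[/eqP aj /eqP bj].
apply: subsigma_funM; first exact: subsigma_fun_cst.
by apply: subsigma_funM; apply: e_others; rewrite ?aj ?bj.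
Qed.

Context {K : R} (K0 : 0 <= K)
  (eK : forall i (g : 'cV[R]_N), blkmask blk i *m g = g ->
     Ex P (fun w => (g^T *m noise_vec w) 0 0 ^+ 4) <= K * qform S g ^+ 2).

(** Cauchy-Schwarz on each product of two squared linear forms keeps the bound a perfect square, so
    the number of forms, which grows with the block size, does not enter. *)
Lemma Ex_sum_linear4 i (I : finType) (g : I -> 'cV[R]_N) :
  (forall r, blkmask blk i *m g r = g r) ->
  Ex P (fun w => (\sum_r ((g r)^T *m noise_vec w) 0 0 ^+ 2) ^+ 2)
    <= K * (\sum_r qform S (g r)) ^+ 2.
Proof.
move=> hg; pose z r w := ((g r)^T *m noise_vec w) 0 0 ^+ 2.
have Lz r : L2 P (z r).
  rewrite /z; under [X in L2 P X]eq_fun do rewrite linear_noiseE.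
  exact: qform_noise_L2.
have z2 r : Ex P (fun w => z r w ^+ 2) <= K * qform S (g r) ^+ 2.
  apply: le_trans (eK (hg r)); rewrite /z.
  by under [X in Ex P X <= _]eq_fun do rewrite -exprM.
have S0 r : 0 <= qform S (g r) by exact: psd_qform.
have zz r s : Ex P (fun w => z r w * z s w) <= K * (qform S (g r) * qform S (g s)).
  have rhs0 : 0 <= K * (qform S (g r) * qform S (g s)) by rewrite !mulr_ge0.
  apply: le_trans (ler_norm _) _.
  rewrite -ler_sqr ?nnegrE// real_normK ?num_real//.
  apply: le_trans (Ex_CauchySchwarz (Lz r) (Lz s)) _.
  apply: le_trans (ler_pM _ _ (z2 r) (z2 s)) _.
  - by apply: Ex_ge0 => w; exact: sqr_ge0.
  - by apply: Ex_ge0 => w; exact: sqr_ge0.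
  - by rewrite le_eqVlt; apply/orP; left; apply/eqP; ring.
have -> : (fun w => (\sum_r ((g r)^T *m noise_vec w) 0 0 ^+ 2) ^+ 2) =
    (fun w => \sum_r \sum_s z r w * z s w).
  apply/funext => w; rewrite expr2 mulr_suml; apply: eq_bigr => r _.
  by rewrite mulr_sumr.
rewrite Ex_sum => [|r]; last by apply: L1_sum => s; exact: L2M.
rewrite expr2 mulr_suml mulr_sumr; apply: ler_sum => r _.
rewrite Ex_sum => [|s]; last exact: L2M.
by rewrite mulr_sumr mulr_sumr; apply: ler_sum => s _; exact: zz.
Qed.

(** The form is |A P_i v|^2, a sum of squares of linear forms given by the rows of [A P_i], each
    supported on subject [i]. *)
Lemma Ex_block_gram2 i (A : 'M[R]_N) :
  Ex P (fun w => qform (blkmask blk i *m (A^T *m A) *m blkmask blk i) (noise_vec w) ^+ 2)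
    <= K * \tr (blkmask blk i *m (A^T *m A) *m blkmask blk i *m S) ^+ 2.
Proof.
pose C := A *m blkmask blk i; pose g r := (row r C)^T.
have CE : blkmask blk i *m (A^T *m A) *m blkmask blk i = C^T *m C.
  by rewrite /C trmx_mul blkmask_tr !mulmxA.
have hg r : blkmask blk i *m g r = g r.
  by rewrite /g -[in LHS](blkmask_tr blk i) -trmx_mul -row_mul /C -mulmxA blkmask_idem.
have := Ex_sum_linear4 hg; rewrite CE.
have -> : \sum_r qform S (g r) = \tr (C^T *m C *m S).
  rewrite -mulmxA mxtrace_mulC /mxtrace; apply: eq_bigr => r _.
  rewrite /qform /bform /g trmxK -row_mul !mxE; apply: eq_bigr => b _.
  by rewrite !mxE.
apply: le_trans; rewrite le_eqVlt; apply/orP; left; apply/eqP; congr (Ex P _).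
apply/funext => w; congr (_ ^+ 2); rewrite -sqnormM sqnorm_sum.
by apply: eq_bigr => r _; rewrite /g trmxK -row_mul [in RHS]mxE.
Qed.

(** The block forms are independent, so only the diagonal terms of the expanded square survive, and
    each variance is bounded by a second moment. *)
Lemma Ex_blockdiag_gram_var (A : 'M[R]_N) (B := \sum_i blkmask blk i *m (A^T *m A) *m blkmask blk i) :
  Ex P (fun w => (qform B (noise_vec w) - \tr (B *m S)) ^+ 2)
    <= K * \sum_i \tr (blkmask blk i *m (A^T *m A) *m blkmask blk i *m S) ^+ 2.
Proof.
pose Bi i := blkmask blk i *m (A^T *m A) *m blkmask blk i.
pose Q i w := qform (Bi i) (noise_vec w); pose m i := \tr (Bi i *m S).
have LQ i : L2 P (Q i) by exact: qform_noise_L2.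
have EQ i : Ex P (Q i) = m i by exact: Ex_qform_noise.
have Lq i : L2 P (fun w => Q i w - m i).
  by apply: L2D; [exact: LQ|exact: L2_cst].
have -> : (fun w => (qform B (noise_vec w) - \tr (B *m S)) ^+ 2) =
    (fun w => \sum_i \sum_j (Q i w - m i) * (Q j w - m j)).
  apply/funext => w.
  have -> : qform B (noise_vec w) - \tr (B *m S) = \sum_i (Q i w - m i).
    have hq : qform B (noise_vec w) = \sum_i Q i w by rewrite /B /qform bform_sum.
    have ht : \tr (B *m S) = \sum_i m i by rewrite /B mulmx_suml raddf_sum.
    by rewrite hq ht sumrB.
  by rewrite expr2 mulr_suml; apply: eq_bigr => i _; rewrite mulr_sumr.
rewrite Ex_sum => [|i]; last by apply: L1_sum => j; exact: L2M.
rewrite mulr_sumr; apply: ler_sum => i _.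
rewrite Ex_sum => [|j]; last exact: L2M.
have EQm j : Ex P (fun w => Q j w - m j) = 0.
  by rewrite ExB ?Ex_cst ?EQ ?subrr//; [exact: L2_L1|exact: L1_cst].
rewrite (bigD1 i)//= big1 ?addr0 => [|j ji].
  apply: le_trans (Ex_block_gram2 i A); rewrite -/(Bi i).
  have -> : (fun w => (Q i w - m i) * (Q i w - m i)) =
      (fun w => (Q i w ^+ 2 + (- 2 * m i) * Q i w) + m i ^+ 2).
    by apply/funext => w; ring.
  have L1a : L1 P (fun w => Q i w ^+ 2) by exact: (proj2 (LQ i)).
  have L1b : L1 P (fun w => (- 2 * m i) * Q i w) by apply: L1Z; exact/L2_L1.
  rewrite ExD; [|exact: L1D|exact: L1_cst].
  rewrite ExD// ExZ ?EQ ?Ex_cst; last exact/L2_L1.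
  by have := sqr_ge0 (m i); lra.
rewrite (Ex_block_othersM indep (i := i)).
- by rewrite EQm mul0r.
- by apply: subsigma_funD; [exact: block_form_block|exact: subsigma_fun_cst].
- by apply: subsigma_funD; [exact: block_form_others|exact: subsigma_fun_cst].
- exact: L2_L1.
- exact: L2_L1.
- exact: L2M.
Qed.

End NoiseMoments.

(** * The model *)

Section BlockDiagonal.
Local Open Scope classical_set_scope.
Local Open Scope ring_scope.
Context {R : realType} {n : nat} {p : 'I_n -> nat}.
Implicit Types B : forall i : 'I_n, 'M[R]_(p i).

Notation blk := (@tagnat.sig1 n p).

Lemma mxdiagEoff B a b : blk a != blk b -> (\mxdiag_i B i) a b = 0.
Proof. by move=> /negbTE ab; rewrite mxE ab mxE. Qed.

Lemma qform_mxdiag B v : qform (\mxdiag_i B i) v = \sum_i qform (B i) (submxcol v i).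
Proof.
rewrite /qform /bform -{1 2}[v]submxcolK -mulmxA mul_mxdiag_mxcol tr_mxcol mul_mxrow_mxcol.
by rewrite summxE; apply: eq_bigr => i _; rewrite mulmxA.
Qed.

Lemma posdef_mxdiag B : (forall i, posdef (B i)) -> posdef (\mxdiag_i B i).
Proof.
move=> pB; split; first by rewrite tr_mxdiag; apply: eq_mxdiag => i; case: (pB i).
move=> v v0; rewrite -/(bform _ _ _) -/(qform _ _) qform_mxdiag.
have [i vi] : exists i, submxcol v i != 0.
  apply: contrapT => /forallNP h; case/eqP: v0; apply/mxcolP => i.
  by rewrite submxcol0; apply: contrapT => /eqP /h.
rewrite (bigD1 i)//=; apply: ltr_pwDl; first exact: (proj2 (pB i)).
by apply: sumr_ge0 => j _; exact/psd_qform/posdef_psd.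
Qed.

Lemma mask_mxdiag_comm B i : blkmask blk i *m \mxdiag_i B i = \mxdiag_i B i *m blkmask blk i.
Proof. by apply: blkmask_comm => a b; exact: mxdiagEoff. Qed.

Lemma submxblockE (C : 'M[R]_(\sum_i p i)) i j x y :
  submxblock C i j x y = C (tagnat.Rank i x) (tagnat.Rank j y).
Proof. by rewrite mxE. Qed.

Lemma mxtrace_mask (C : 'M[R]_(\sum_i p i)) i :
  \tr (blkmask blk i *m C) = \tr (submxblock C i i).
Proof.
rewrite -[blkmask blk i *m C]submxblockK mxtrace_mxblock (bigD1 i)//= [X in _ + X]big1 => [|j ji].
  rewrite addr0; apply: eq_bigr => x _.
  by rewrite !submxblockE blkmaskMl tagnat.Rank1K eqxx mul1r.
by rewrite /mxtrace big1// => x _; rewrite submxblockE blkmaskMl tagnat.Rank1K (negbTE ji) mul0r.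
Qed.

Lemma mask_sum_mxdiag (C : 'M[R]_(\sum_i p i)) :
  \sum_i blkmask blk i *m C *m blkmask blk i = \mxdiag_i submxblock C i i.
Proof.
apply/mxblockP => i j; rewrite submxblock_sum (bigD1 i)//= [X in _ + X]big1 ?addr0 => [|l li]; last first.
  by apply/matrixP => x y; rewrite submxblockE blkmaskMr blkmaskMl tagnat.Rank1K eq_sym (negbTE li) !mul0r mxE.
have [<-|ij] := eqVneq i j.
  rewrite submxblock_diag; apply/matrixP => x y.
  by rewrite !submxblockE blkmaskMr blkmaskMl !tagnat.Rank1K eqxx mul1r mulr1.
apply/matrixP => x y; rewrite !submxblockE blkmaskMr mxdiagEoff ?tagnat.Rank1K//.
by rewrite eq_sym (negbTE ij) mulr0.
Qed.

End BlockDiagonal.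

(** * Noise coordinates of the model and their moments *)

Section ModelFacts.
Local Open Scope classical_set_scope.
Local Open Scope ring_scope.
Context {R : realType} {n : nat} (M : model R n).

Notation N := (\sum_i nobs M i)%N.
Notation blk := (@tagnat.sig1 n (nobs M)).
Notation P := (prob M).

Lemma Sigma_posdef : posdef (Sigma M).
Proof. by apply: posdef_mxdiag => i; exact: cov_posdef. Qed.

Lemma wcor_posdef_mx : posdef (wcor M).
Proof. by apply: posdef_mxdiag => i; exact: wcor_posdef. Qed.

Lemma Sigma_blockdiag : blockdiag_mx blk (Sigma M).
Proof. by move=> a b; exact: mxdiagEoff. Qed.

Lemma size_gt0 : (0 < n)%N -> (0 < N)%N.
Proof.
by move=> n0; rewrite (bigD1 (Ordinal n0))//= addn_gt0 nobs_gt0.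
Qed.

Definition smoother : 'M[R]_N := design M *m invmx (normal_mx M) *m (design M)^T.

Lemma hatE : hat M = smoother *m invmx (wcor M).
Proof. by []. Qed.

Lemma smoother_hat : possemidef smoother /\
  loewner (smoother *m invmx (wcor M) *m smoother) smoother.
Proof.
apply: loewner_hat (wcor_posdef_mx) _ (normal_mx_unit M).
by apply: psd_sum => k; apply: psdZ; [exact: lam_ge0|exact: penalty_psd].
Qed.

Lemma mxtrace_hat_block i : \tr (hat_block M i) = blocktr (A := hat M) (P := blkmask blk) i.
Proof. by rewrite /blocktr mxtrace_mask. Qed.

(** [W^{1/2}] commutes with the projection on a subject, so the similarity by it leaves the trace of
    each diagonal block unchanged. *)
Lemma mxtrace_hat_sym2_block i :
  \tr (hat_sym2_block M i) = \tr (blkmask blk i *m (hat M *m hat M)).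
Proof.
have pW := wcor_posdef_mx; have uS := sqrtmx_unit pW.
rewrite /hat_sym2_block -mxtrace_mask /hat_sym; set S := sqrtmx _ in uS *.
have PS : blkmask blk i *m S = S *m blkmask blk i.
  apply: sqrtmx_comm => //; [exact: blkmask_tr|exact: blkmask_idem|exact: mask_mxdiag_comm].
rewrite !mulmxA mulmxK// (invmx_comm uS PS) mxtrace_mulC.
by rewrite !mulmxA mulmxV// mul1mx.
Qed.

Definition err (a : 'I_N) (w : sample M) : R := noise M w a 0.

Lemma errE a w : err a w = response (tagnat.sig2 a) w - mean M (blk a) (tagnat.sig2 a) 0.
Proof. by rewrite /err /noise /resp /mu !mxE. Qed.

Lemma noise_errE w : noise_vec (e := err) w = noise M w.
Proof. by apply/matrixP => a b; rewrite ord1 mxE. Qed.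

Lemma err_measurable a : measurable_fun setT (err a).
Proof.
rewrite (_ : err a = fun w => response (tagnat.sig2 a) w - mean M (blk a) (tagnat.sig2 a) 0).
  exact: measurable_funB.
by apply/funext => w; rewrite errE.
Qed.

Lemma err_block a : subsigma_fun (block_gen (@response R n M) (blk a)) (err a).
Proof.
rewrite (_ : err a = fun w => response (tagnat.sig2 a) w + - mean M (blk a) (tagnat.sig2 a) 0).
  by apply: subsigma_funD; [exact: block_gen_fun|exact: subsigma_fun_cst].
by apply/funext => w; rewrite errE.
Qed.

Lemma err_others a i : blk a != i -> subsigma_fun (others_gen (@response R n M) i) (err a).
Proof.
move=> ai.
rewrite (_ : err a = fun w => response (tagnat.sig2 a) w + - mean M (blk a) (tagnat.sig2 a) 0).
  by apply: subsigma_funD; [exact: others_gen_fun|exact: subsigma_fun_cst].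
by apply/funext => w; rewrite errE.
Qed.

Context {K : R} (K0 : 0 < K) (c1 : forall (i : 'I_n) (u : 'cV[R]_(nobs M i)), sqnorm u = 1 ->
    ('E_P[fun w => ((u^T *m std_noise i w) 0 0 ^+ 4)%R] <= K%:E)%E).

Lemma linear_measurable (g : 'cV[R]_N) :
  measurable_fun setT (fun w => (g^T *m noise M w) 0 0).
Proof.
rewrite (_ : (fun w => _) = (fun w => \sum_a g a 0 * err a w)).
  apply: measurable_sum => a; apply: measurable_funM => //; exact: err_measurable.
by apply/funext => w; rewrite mxE; apply: eq_bigr => a _; rewrite [g^T _ _]mxE.
Qed.

(** Condition 1 concerns unit directions of the standardised noise. The direction here is
    [Sigma_i^{1/2} h] divided by its norm, and homogeneity of degree 4 turns that norm into the
    square of the variance; [h = 0] is treated apart. *)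
Lemma err_fourth i (g : 'cV[R]_N) : blkmask blk i *m g = g ->
  L1 P (fun w => (g^T *m noise M w) 0 0 ^+ 4) /\
  Ex P (fun w => (g^T *m noise M w) 0 0 ^+ 4) <= K * qform (Sigma M) g ^+ 2.
Proof.
move=> hg; pose h := submxcol g i.
have hz j : j != i -> submxcol g j = 0.
  move=> ji; apply/matrixP => x y.
  have := congr1 (fun C : 'cV_N => C (tagnat.Rank j x) y) hg.
  rewrite /blkmask mul_diag_mx mxE [X in X * _]mxE tagnat.Rank1K (negbTE ji) mul0r => e.
  by rewrite [LHS]mxE -e mxE.
have gE w : (g^T *m noise M w) 0 0 = (h^T *m (resp_block i w - mean M i)) 0 0.
  rewrite -[g]submxcolK tr_mxcol /noise /resp /mu -mxcolB mul_mxrow_mxcol.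
  rewrite summxE (bigD1 i)//= big1 ?addr0// => j ji.
  by rewrite hz// trmx0 mul0mx mxE.
have sE : qform (Sigma M) g = qform (cov M i) h.
  rewrite /Sigma qform_mxdiag (bigD1 i)//= big1 ?addr0// => j ji.
  by rewrite hz// /qform /bform mulmx0 mxE.
have pC := cov_posdef M i; have [_ SS] := sqrtmxP (posdef_psd pC).
have Ss := sqrtmx_tr (posdef_psd pC); have uS := sqrtmx_unit pC.
set S := sqrtmx _ in SS Ss uS.
have [g0|g0] := eqVneq h 0.
  have -> : (fun w => (g^T *m noise M w) 0 0 ^+ 4) = fun=> 0.
    by apply/funext => w; rewrite gE g0 trmx0 mul0mx mxE expr0n.
  by split; [exact: L1_cst|rewrite Ex_cst mulr_ge0 ?sqr_ge0// ltW].
set s := qform (cov M i) h in sE.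
have s0 : 0 < s by exact: (proj2 pC).
pose u := (Num.sqrt s)^-1 *: (S *m h).
have u1 : sqnorm u = 1.
  rewrite sqnormE /qform bformZl bformZr -/(qform _ _) qform_congr mulmx1 Ss SS -/s.
  by rewrite mulrA -expr2 exprVn sqr_sqrtr ?mulVf ?gt_eqF// ltW.
have e w : (g^T *m noise M w) 0 0 ^+ 4 = s ^+ 2 * (u^T *m std_noise i w) 0 0 ^+ 4.
  have -> : (u^T *m std_noise i w) 0 0 = (Num.sqrt s)^-1 * (g^T *m noise M w) 0 0.
    rewrite /u linearZ /= -scalemxAl mxE trmx_mul Ss gE /std_noise.
    by rewrite -/S -mulmxA mulKVmx.
  have q4 : Num.sqrt s ^+ 4 = s ^+ 2 by rewrite -[4%N]/(2 * 2)%N exprM sqr_sqrtr// ltW.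
  rewrite exprMn exprVn q4 mulrA divff ?mul1r//.
  by rewrite expf_eq0 /= gt_eqF.
have mf : measurable_fun setT (fun w => (u^T *m std_noise i w) 0 0 ^+ 4).
  rewrite (_ : (fun w => _) = fun w => (s ^+ 2)^-1 * (g^T *m noise M w) 0 0 ^+ 4).
    by apply: measurable_funM => //; apply: measurable_funX; exact: linear_measurable.
  by apply/funext => w; rewrite e mulrA mulVf ?mul1r// expf_eq0 /= gt_eqF.
have := c1 u1 => hK.
have f0 w : 0 <= (u^T *m std_noise i w) 0 0 ^+ 4 by rewrite exprn_even_ge0.
(* The bound of Condition 1 is an inequality between extended reals, so it also gives integrability,
   without which [Ex] would not be the true expectation. *)
have Lf : L1 P (fun w => (u^T *m std_noise i w) 0 0 ^+ 4).
  apply/integrableP; split; first exact/measurable_EFinP.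
  apply: le_lt_trans (ltry K); apply: le_trans hK; rewrite unlock.
  by under eq_integral do rewrite /= ger0_norm//.
have -> : (fun w => (g^T *m noise M w) 0 0 ^+ 4) =
    fun w => s ^+ 2 * (u^T *m std_noise i w) 0 0 ^+ 4 by apply/funext.
split; first exact: L1Z.
rewrite ExZ// sE mulrC ler_pM2r ?exprn_gt0//.
by rewrite -lee_fin -ExE.
Qed.

Lemma err_L4 a : L2 P (fun w => err a w ^+ 2).
Proof.
have hd : (blkmask blk (blk a) : 'M[R]_N) *m delta_mx a 0 = delta_mx a 0 :> 'cV_N.
  apply/matrixP => x y; rewrite mul_diag_mx !mxE.
  by case: (x =P a) => [->|]; rewrite ?eqxx ?mul1r// mulr0.
have [L _] := err_fourth hd.
split; first by apply: measurable_funX; exact: err_measurable.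
have -> : (fun w => err a w ^+ 2 ^+ 2) = fun w => ((delta_mx a 0 : 'cV[R]_N)^T *m noise M w) 0 0 ^+ 4 => //.
apply/funext => w; rewrite -exprM; congr (_ ^+ 4).
by rewrite trmx_delta -rowE mxE.
Qed.

Lemma err_L2 a : L2 P (err a).
Proof. by split; [exact: err_measurable|exact/L2_L1/err_L4]. Qed.

Lemma Ex_err a : Ex P (err a) = 0.
Proof.
have -> : err a = fun w => response (tagnat.sig2 a) w - mean M (blk a) (tagnat.sig2 a) 0.
  by apply/funext => w; rewrite errE.
rewrite ExB; last exact: L1_cst.
  by rewrite Ex_cst /Ex response_mean /= subrr.
have := L1D (L2_L1 (err_L2 a)) (L1_cst P (mean M (blk a) (tagnat.sig2 a) 0)).
by under [X in L1 _ X]eq_fun do rewrite errE subrK.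
Qed.

Lemma Ex_err_cov a b : blk a = blk b -> Ex P (fun w => err a w * err b w) = Sigma M a b.
Proof.
move=> ab; pose f (i : 'I_n) (x : 'I_(nobs M i)) w := response x w - mean M i x 0.
(* The right-hand side copies the entry of a block diagonal matrix, where the two subjects are only
   propositionally equal; generalising over them allows the substitution. *)
have key (i j : 'I_n) (x : 'I_(nobs M i)) (z : 'I_(nobs M j)) : i = j ->
    Ex P (fun w => f i x w * f j z w) = (if i == j then conform_mx 0 (cov M i) else 0) x z.
  move=> ij; subst j; rewrite eqxx conform_mx_id; apply: EFin_inj; rewrite -response_cov.
  rewrite /Ex covariance.unlock !response_mean /= fineK//.
  by have := response_cov x z; rewrite covariance.unlock !response_mean /= => ->.
rewrite [RHS]mxE -key//; congr (Ex P _); apply/funext => w; by rewrite !errE.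
Qed.

End ModelFacts.

(** * Expansion of the criterion *)

Section QuadraticIdentities.
Local Open Scope classical_set_scope.
Local Open Scope ring_scope.
Context {R : realType} {n N : nat} (blk : 'I_N -> 'I_n).
Implicit Types (A : 'M[R]_N) (u v b : 'cV[R]_N).

Let D A : 'M[R]_N := blockdiag_hat (A := A) (P := blkmask blk).

Lemma blockdiag_hat_blkmask A i : D A *m blkmask blk i = blkmask blk i *m A *m blkmask blk i.
Proof.
rewrite /D /blockdiag_hat mulmx_suml (bigD1 i)//= [X in _ + X]big1 ?addr0 => [|j ji].
  by rewrite -!mulmxA blkmask_idem.
by rewrite -mulmxA blkmask_disj ?mulmx0.
Qed.

Lemma blkmask_blockdiag_hat A i : blkmask blk i *m D A = blkmask blk i *m A *m blkmask blk i.
Proof.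
rewrite /D /blockdiag_hat mulmx_sumr (bigD1 i)//= [X in _ + X]big1 ?addr0 => [|j ji].
  by rewrite !mulmxA blkmask_idem.
by rewrite !mulmxA blkmask_disj ?mul0mx// eq_sym.
Qed.

(** Here [v] is the noise and [v - r] the residual. The term [v^T D v] coming from the correction
    cancels the diagonal blocks of [A]. Of the two cross terms, [v^T D r] is expanded by
    [r = A v - b], which creates [D A] with diagonal blocks [D D]; the other is kept as a product
    with [r]. *)
Lemma criterion_identity A v b (r := A *m v - b) :
  bform 1%:M b v - qform A v + qform (D A) (v - r) =
  bform 1%:M (b + D A *m b) v - qform (offdiag blk (A + D A *m A)) v
    - qform (D A *m D A) v - bform 1%:M (D A *m v) r + qform (D A) r.
Proof.
have -> : offdiag blk (A + D A *m A) = A + D A *m A - D A - D A *m D A.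
  rewrite offdiagE -[RHS]addrA -opprD; congr (_ + - _).
  rewrite -[in RHS](mulmx1 (D A *m D A)) -(blkmask_sum blk) mulmx_sumr.
  have -> : forall x, D A + x = \sum_i blkmask blk i *m A *m blkmask blk i + x by [].
  rewrite -big_split /=; apply: eq_bigr => i _.
  rewrite -/(D A) mulmxDr mulmxDl; congr (_ + _).
  rewrite -!mulmxA blockdiag_hat_blkmask [blkmask blk i *m (D A *m _)]mulmxA blkmask_blockdiag_hat.
  rewrite -blockdiag_hat_blkmask -!mulmxA; congr (_ *m _).
  by rewrite mulmxA -blockdiag_hat_blkmask.
have e1 x y B C : bform (B *m C) x y = bform B x (C *m y).
  by rewrite /bform !mulmxA.
have e2 x y : bform 1%:M (D A *m x) y = bform (D A) y x.
  by rewrite bformC trmx1 /bform mulmx1 mulmxA.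
rewrite /qform /r !(bformB, bformN, bformD, bformBl, bformBr, bformNl, bformNr, bformDl, bformDr, e1, e2).
ring.
Qed.

Lemma bform1_amgm (c : R) u v : 0 < c ->
  `|bform 1%:M u v| <= c / 2 * sqnorm v + sqnorm u / (2 * c).
Proof.
move=> c0; rewrite !sqnormE.
have h (t : R) : t = 1 \/ t = -1 -> 0 <= qform 1%:M u + t * c * bform 1%:M u v *+ 2 + c ^+ 2 * qform 1%:M v.
  move=> ht; have := psd_qform (u + (t * c) *: v) (psd1 _).
  rewrite /qform bformDl !bformDr !bformZl !bformZr [bform _ v u]bformC trmx1.
  by case: ht => ->; rewrite mulr2n; lra.
have h1 := h 1 (or_introl erefl); have h2 := h (-1) (or_intror erefl).
move: h1 h2; set p := qform _ u; set q := qform _ v; set x := bform _ u v => h1 h2.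
have -> : c / 2 * q + p / (2 * c) = (p + c ^+ 2 * q) / (2 * c) by field; rewrite gt_eqF.
rewrite ler_pdivlMr ?mulr_gt0// -[X in _ * X]gtr0_norm ?mulr_gt0// -normrM.
by rewrite ler_norml; apply/andP; split; rewrite mulr2n in h1 h2; lra.
Qed.

Lemma sqnorm_loss_identity A v b :
  sqnorm (A *m v - b) = qform (A^T *m A) v - 2 * bform 1%:M (A^T *m b) v + sqnorm b.
Proof.
rewrite !sqnormE /qform bformBl !bformBr.
have -> : bform (A^T *m A) v v = bform 1%:M (A *m v) (A *m v).
  by rewrite /bform trmx_mul mulmx1 !mulmxA.
have e : bform 1%:M (A^T *m b) v = bform 1%:M b (A *m v).
  by rewrite /bform trmx_mul trmxK !mulmx1 !mulmxA.
rewrite e [bform 1%:M (A *m v) b]bformC trmx1; ring.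
Qed.

End QuadraticIdentities.

(** The fluctuations of [L] add up to at most [4 c rho], hence [rho <= 2 L] as [c <= 1/8]. The
    remaining terms total at most [21/8 c rho + 2 c L], and 9 is a round bound for the resulting
    multiple of [c L]. *)
Lemma criterion_bound (R : realType) (rho c lin off maj dd x q de dr v7 v8 v9 L Z : R) :
  0 < rho -> 0 < c -> c <= 8^-1 -> 0 <= maj -> 0 <= de -> 0 <= L ->
  (rho ^+ 2)^-1 * (lin ^+ 2 + (off ^+ 2 + (v7 ^+ 2 + (v8 ^+ 2 + v9 ^+ 2))))
    + rho^-1 * (maj + de) < c ^+ 2 ->
  L = rho + v7 + v8 - 2 * v9 -> `|dd| <= maj -> `|x| <= c / 2 * L + de / (2 * c) ->
  `|q| <= c / 2 * L + dr / (2 * c) -> dr <= 2 * c ^+ 2 * L ->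
  Z = lin - off - dd - x + q -> `|Z| <= 9 * c * L.
Proof.
move=> r0 c0 c8 maj0 de0 L0 psi LE hdd hx hq hdr ->.
have r2 : 0 < (rho ^+ 2)^-1 by rewrite invr_gt0 exprn_gt0.
have ri : 0 < rho^-1 by rewrite invr_gt0.
set T := lin ^+ 2 + _ in psi.
have T0 : 0 <= T by rewrite /T !addr_ge0 ?sqr_ge0.
have hT : T < (c * rho) ^+ 2.
  rewrite exprMn -ltr_pdivrMr ?exprn_gt0// mulrC; apply: le_lt_trans psi.
  by rewrite lerDl mulr_ge0 ?addr_ge0// ltW.
have hM : maj + de < c ^+ 2 * rho.
  rewrite -ltr_pdivrMr// mulrC; apply: le_lt_trans psi.
  by rewrite lerDr mulr_ge0// ltW.
have cr : 0 < c * rho by rewrite mulr_gt0.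
have sq y : y ^+ 2 <= T -> `|y| <= c * rho.
  move=> yT; rewrite -ler_sqr ?nnegrE ?(ltW cr)// real_normK ?num_real//.
  by rewrite (le_trans yT)// ltW.
have s1 := sqr_ge0 lin; have s2 := sqr_ge0 off; have s3 := sqr_ge0 v7.
have s4 := sqr_ge0 v8; have s5 := sqr_ge0 v9.
have a1 : `|lin| <= c * rho by apply: sq; rewrite /T; lra.
have a2 : `|off| <= c * rho by apply: sq; rewrite /T; lra.
have a3 : `|v7| <= c * rho by apply: sq; rewrite /T; lra.
have a4 : `|v8| <= c * rho by apply: sq; rewrite /T; lra.
have a5 : `|v9| <= c * rho by apply: sq; rewrite /T; lra.
have hde : de / (2 * c) <= c * rho / 2.
  rewrite ler_pdivrMr ?mulr_gt0//; have -> : c * rho / 2 * (2 * c) = c ^+ 2 * rho by field.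
  by lra.
have hdr' : dr / (2 * c) <= c * L.
  rewrite ler_pdivrMr ?mulr_gt0//.
  by have -> : c * L * (2 * c) = 2 * c ^+ 2 * L by ring.
have hc2 : c ^+ 2 * rho <= 8^-1 * (c * rho).
  by rewrite expr2 -mulrA ler_wpM2r// ltW.
have hcr : c * rho <= 8^-1 * rho by rewrite ler_wpM2r// ltW.
move: a1 a2 a3 a4 a5 hdd hx hq; rewrite !ler_norml.
move=> /andP[? ?] /andP[? ?] /andP[? ?] /andP[? ?] /andP[? ?] /andP[? ?] /andP[? ?] /andP[? ?].
have rL : rho <= 2 * L by lra.
have crL : c * rho <= 2 * (c * L) by rewrite mulrCA ler_wpM2l// ltW.
have -> : 9 * c * L = 9 * (c * L) by ring.
have cL : 0 <= c * L by rewrite mulr_ge0// ltW.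
have cL2 : c / 2 * L = c * L / 2 by ring.
by apply/andP; split; lra.
Qed.

(** The coefficients of [t] sum to [8 + K + 2], which is the origin of [10 + K]; those of [p] sum to
    5. *)
Lemma moment_sum_bound (R : realType) (K x p t e1 e2 e3 e4 e5 : R) :
  0 < K -> 0 < x -> 0 <= p -> 0 <= t -> e1 <= 4 * x * p -> e2 <= 8 * x * t ->
  e3 <= K * x * t -> e4 <= 2 * x * t -> e5 <= x * p ->
  e1 + (e2 + (e3 + (e4 + e5))) <= (10 + K) * x * (p + t).
Proof.
move=> K0 x0 p0 t0 h1 h2 h3 h4 h5.
have xp : 0 <= x * p by rewrite mulr_ge0// ltW.
have Kxp : 0 <= K * (x * p) by rewrite mulr_ge0// ltW.
have -> : (10 + K) * x * (p + t) = 10 * (x * p) + 10 * (x * t) + K * (x * p) + K * x * t by ring.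
by rewrite -!mulrA in h1 h2 h4 h5 *; rewrite -mulrA in h3; lra.
Qed.

Lemma Ex_weighted_sum {d} {T : measurableType d} {R : realType} {P : probability T R}
    (c c' : R) (f1 f2 f3 f4 f5 g1 g2 : T -> R)
    (F := fun w => c * (f1 w + (f2 w + (f3 w + (f4 w + f5 w)))) + c' * (g1 w + g2 w)) :
  L1 P f1 -> L1 P f2 -> L1 P f3 -> L1 P f4 -> L1 P f5 -> L1 P g1 -> L1 P g2 ->
  L1 P F /\ Ex P F =
    c * (Ex P f1 + (Ex P f2 + (Ex P f3 + (Ex P f4 + Ex P f5)))) + c' * (Ex P g1 + Ex P g2).
Proof.
move=> L1 L2 L3 L4 L5 M1 M2.
have La := L1D L4 L5; have Lb := L1D L3 La; have Lc := L1D L2 Lb; have Ld := L1D L1 Lc.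
have Le := L1D M1 M2; have Lf := L1Z c Ld; have Lg := L1Z c' Le.
split; first exact: L1D.
by rewrite /F (ExD Lf Lg) (ExZ c Ld) (ExZ c' Le) (ExD L1 Lc) (ExD L2 Lb) (ExD L3 La) (ExD L4 L5) (ExD M1 M2).
Qed.

(** * Deviation bound for a fixed number of subjects *)

Section Criterion.
Local Open Scope classical_set_scope.
Local Open Scope ring_scope.
Context {R : realType} {n : nat} (M : model R n) (n0 : (0 < n)%N).

Notation N := (\sum_i nobs M i)%N.
Notation blk := (@tagnat.sig1 n (nobs M)).
Notation P := (prob M).

Context {K : R} (K0 : 0 < K) (c1 : forall (i : 'I_n) (u : 'cV[R]_(nobs M i)), sqnorm u = 1 ->
    ('E_P[fun w => ((u^T *m std_noise i w) 0 0 ^+ 4)%R] <= K%:E)%E).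

Let A := hat M.
Let S := Sigma M.
Let W := wcor M.
Let D : 'M[R]_N := blockdiag_hat (A := A) (P := blkmask blk).
Definition bias : 'cV[R]_N := (1%:M - hat M) *m mu M.
Definition fit_var : R := \tr (hat M *m Sigma M *m (hat M)^T).
Let b := bias.
Let t := fit_var.
Let r w := A *m noise M w - b.
Definition tot_risk : R := sqnorm bias + fit_var.
Let rho := tot_risk.

Let nR0 : 0 < n%:R :> R. Proof. by rewrite ltr0n. Qed.

Let pS : posdef S := Sigma_posdef M.
Let pW : posdef W := wcor_posdef_mx M.
Let N0 : (0 < N)%N := size_gt0 M n0.

Lemma fit_var_ge0 : 0 <= t.
Proof. exact/psd_tr_ge0/psd_cov_congr. Qed.

Lemma lossE w : loss M w = n%:R^-1 * sqnorm (r w).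
Proof.
rewrite /loss /r; congr (_ * sqnorm _).
by rewrite /b /bias mulmxBl mul1mx /A /noise mulmxBr opprB addrA subrK.
Qed.

Lemma residualE w : residual w = noise M w - r w.
Proof.
rewrite /residual /r /b /bias !mulmxBl !mul1mx /A /noise mulmxBr.
by apply/matrixP => i j; rewrite !mxE; ring.
Qed.

Let qform_D x : qform D x = \sum_(i < n) ((submxcol x i)^T *m hat_block M i *m submxcol x i) 0 0.
Proof. by rewrite /D /blockdiag_hat mask_sum_mxdiag qform_mxdiag. Qed.

Lemma criterionE w : n%:R / 2 * (LsoCV M w - loss M w - n%:R^-1 * sqnorm (noise M w)) =
  bform 1%:M (b + D *m b) (noise M w) - qform (offdiag blk (A + D *m A)) (noise M w)
    - qform (D *m D) (noise M w) - bform 1%:M (D *m noise M w) (r w) + qform D (r w).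
Proof.
have := criterion_identity blk A (noise M w) b; rewrite /= -/D -/(r w) => <-.
have key v : bform 1%:M b v - qform A v = - bform 1%:M v (A *m v - b).
  by rewrite bformBr opprB [bform _ b _]bformC trmx1 /qform /bform !mulmx1 !mulmxA.
rewrite /LsoCV -qform_D residualE lossE key -/(r w).
move: (noise M w) (r w) => v x; rewrite !sqnormE.
have -> : qform 1%:M (v - x) = qform 1%:M v - 2 * bform 1%:M v x + qform 1%:M x.
  rewrite /qform bformBl !bformBr [bform _ x v]bformC trmx1; ring.
have : n%:R != 0 :> R by rewrite gt_eqF.
by move=> ?; field.
Qed.

Let mS : possemidef S := posdef_psd pS.
Let bS : blockdiag_mx blk S := @Sigma_blockdiag R n M.

Let nv w : noise_vec (e := @err R n M) w = noise M w := noise_errE w.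

Let qL2 B : L2 P (fun w => qform B (noise M w)).
Proof.
have := qform_noise_L2 (@err_measurable R n M) (err_L4 K0 c1) B.
by under [X in L2 _ X]eq_fun do rewrite nv.
Qed.

Let qEx B : Ex P (fun w => qform B (noise M w)) = \tr (B *m S).
Proof.
have := Ex_qform_noise (@response_indep R n M) mS bS (@err_block R n M) (@err_others R n M)
  (@err_measurable R n M) (err_L4 K0 c1) (Ex_err K0 c1) (@Ex_err_cov R n M) B.
by under [X in Ex _ X]eq_fun do rewrite nv.
Qed.

Let lE c w : bform 1%:M c (noise M w) = (c^T *m noise M w) 0 0.
Proof. by rewrite /bform mulmx1. Qed.

Let lL2 c : L2 P (fun w => bform 1%:M c (noise M w)).
Proof.
have := linear_noise_L2 (@err_measurable R n M) (err_L4 K0 c1) c.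
by under [X in L2 _ X]eq_fun do rewrite nv -lE.
Qed.

Let lEx0 c : Ex P (fun w => bform 1%:M c (noise M w)) = 0.
Proof.
have := Ex_linear_noise (@err_measurable R n M) (err_L4 K0 c1) (Ex_err K0 c1) c.
by under [X in Ex _ X]eq_fun do rewrite nv -lE.
Qed.

Let lEx c : Ex P (fun w => bform 1%:M c (noise M w) ^+ 2) = qform S c.
Proof.
have := Ex_linear_noise2 (@response_indep R n M) mS bS (@err_block R n M) (@err_others R n M)
  (@err_measurable R n M) (err_L4 K0 c1) (Ex_err K0 c1) (@Ex_err_cov R n M) c.
by under [X in Ex _ X]eq_fun do rewrite nv -lE.
Qed.

Let oEx B : Ex P (fun w => qform (offdiag blk B) (noise M w) ^+ 2) <= 2 * \tr (B *m S *m B^T *m S).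
Proof.
have := Ex_offdiag_noise2 (@response_indep R n M) mS bS (@err_block R n M) (@err_others R n M)
  (@err_measurable R n M) (err_L4 K0 c1) (Ex_err K0 c1) (@Ex_err_cov R n M) B.
by under [X in Ex _ X]eq_fun do rewrite nv.
Qed.

Let B2 := A^T *m A.
Let B2d : 'M[R]_N := \sum_i blkmask blk i *m B2 *m blkmask blk i.

Let dEx : Ex P (fun w => (qform B2d (noise M w) - \tr (B2d *m S)) ^+ 2) <=
  K * \sum_i \tr (blkmask blk i *m B2 *m blkmask blk i *m S) ^+ 2.
Proof.
have eK i (g : 'cV[R]_N) : blkmask blk i *m g = g ->
    Ex P (fun w => (g^T *m noise_vec (e := @err R n M) w) 0 0 ^+ 4) <= K * qform S g ^+ 2.
  move=> hg; under [X in Ex _ X]eq_fun do rewrite nv.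
  by have [] := err_fourth K0 c1 hg.
have := Ex_blockdiag_gram_var (@response_indep R n M) mS bS (@err_block R n M) (@err_others R n M)
  (@err_measurable R n M) (err_L4 K0 c1) (Ex_err K0 c1) (@Ex_err_cov R n M) (ltW K0) eK A; rewrite /=.
by under [X in Ex _ X]eq_fun do rewrite nv.
Qed.

Let trB2d : \sum_i \tr (blkmask blk i *m B2 *m blkmask blk i *m S) = t.
Proof.
transitivity (\tr (B2 *m S)).
  rewrite -[in RHS](mul1mx B2) -(blkmask_sum blk) !mulmx_suml raddf_sum.
  apply: eq_bigr => i _; rewrite -mulmxA (blkmask_comm i bS) mulmxA mxtrace_mulC.
  by rewrite !mulmxA blkmask_idem.
by rewrite /B2 -mulmxA mxtrace_mulC.
Qed.

Let trB2dS : \tr (B2d *m S) = t.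
Proof. by rewrite -trB2d /B2d mulmx_suml raddf_sum. Qed.

Lemma riskE : n%:R * risk M = rho.
Proof.
have -> : risk M = Ex P (loss M) by [].
have -> : loss M = (fun w => n%:R^-1 * (qform B2 (noise M w) - 2 * bform 1%:M (A^T *m b) (noise M w) + sqnorm b)).
  by apply/funext => w; rewrite lossE /r sqnorm_loss_identity.
have L1a : L1 P (fun w => qform B2 (noise M w)) by exact: L2_L1.
have L1b : L1 P (fun w => 2 * bform 1%:M (A^T *m b) (noise M w)) by apply: L1Z; exact: L2_L1.
rewrite ExZ; last by apply: L1D; [exact: L1B|exact: L1_cst].
rewrite ExD ?ExB ?ExZ ?lEx0 ?qEx ?Ex_cst //; [|exact: L2_L1|exact: L1B|exact: L1_cst].
rewrite mulr0 subr0 mulrA divff ?gt_eqF// mul1r addrC; congr (_ + _).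
by rewrite /B2 -mulmxA mxtrace_mulC.
Qed.

Let s := lambda_max (S *m invmx W).
Let l := lambda_max W.
Let kap := lambda_max (invmx W).
Let tau i := \tr (hat_block M i).
Let H := smoother M.

Let xiE : xi M = s * l. Proof. by []. Qed.

Let Ss : loewner S (s *: W). Proof. exact: lambda_max_pencil N0 (proj1 pS) pW. Qed.
Let Wl : loewner W (l *: 1%:M). Proof. exact: lambda_max_sym N0 (proj1 pW). Qed.
Let pV : posdef (invmx W) := posdef_inv pW.
Let Vk : loewner (invmx W) (kap *: 1%:M). Proof. exact: lambda_max_sym N0 (proj1 pV). Qed.
Let s0 : 0 < s. Proof. exact: posdef_loewner_gt0 N0 pS (posdef_psd pW) Ss. Qed.
Let l0 : 0 < l. Proof. exact: posdef_loewner_gt0 N0 pW (psd1 _) Wl. Qed.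
Let k0 : 0 < kap. Proof. exact: posdef_loewner_gt0 N0 pV (psd1 _) Vk. Qed.

Lemma xi_gt0 : 0 < xi M. Proof. by rewrite xiE mulr_gt0. Qed.

Lemma wcor_cond_gt0 : 0 < lambda_max (wcor M) * lambda_max (invmx (wcor M)).
Proof. exact: mulr_gt0. Qed.

Let pH : possemidef H := proj1 (smoother_hat M).
Let Hle : loewner (H *m invmx W *m H) H := proj2 (smoother_hat M).
Let AE : A = H *m invmx W := hatE M.
Let PW i : blkmask blk i *m W = W *m blkmask blk i := mask_mxdiag_comm _ i.
Let Ps := @blkmask_tr R n N blk.
Let PP := @blkmask_idem R n N blk.
Let P0 := @blkmask_disj R n N blk.
Let P1 := @blkmask_sum R n N blk.

Lemma hat_block_tr_ge0 i : 0 <= tau i.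
Proof. by rewrite /tau mxtrace_hat_block; exact: (blocktr_ge0 pW pH AE Ps PP PW). Qed.

Lemma fit_var0_hat0 : t = 0 -> hat M = 0.
Proof. exact: mxtrace_fit0. Qed.

Let D_le (x : 'cV[R]_N) tm : 0 <= tm -> (forall i, tau i <= tm) ->
  sqnorm (D *m x) <= l * kap * tm ^+ 2 * sqnorm x.
Proof.
move=> tm0 htm; rewrite sqnormM sqnormE -/(qform _ _).
have ht i : blocktr (A := A) (P := blkmask blk) i <= tm by rewrite -mxtrace_hat_block; exact: htm.
have := loewner_blockdiag_hat pW pH AE Ps PP P0 P1 PW (ltW l0) Wl Vk tm0 ht x.
by rewrite /qform bformZ.
Qed.

Let sum_tau tm : 0 <= tm -> (forall i, tau i <= tm) ->
  \sum_i blocktr (A := A) (P := blkmask blk) i ^+ 2 <= n%:R * tm ^+ 2.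
Proof.
move=> tm0 htm; apply: (@le_trans _ _ (\sum_(i < n) tm ^+ 2)).
  apply: ler_sum => i _; rewrite -mxtrace_hat_block ler_sqr ?nnegrE//; first exact: htm.
  exact: hat_block_tr_ge0.
by rewrite sumr_const card_ord mulr_natl.
Qed.

Let Dmaj : 'M[R]_N := blockdiag_hat_majorant (W := W) (H := H) (P := blkmask blk) (l := l).

Let L1q B : L1 P (fun w => qform B (noise M w)). Proof. exact: L2_L1. Qed.
Let L1qq B c : L1 P (fun w => (qform B (noise M w) - c) ^+ 2).
Proof. by apply: (proj2 (L2D (qL2 B) (L2_cst P (- c)))). Qed.
Let L1qs B : L1 P (fun w => qform B (noise M w) ^+ 2). Proof. exact: (proj2 (qL2 B)). Qed.
Let L1ls c : L1 P (fun w => bform 1%:M c (noise M w) ^+ 2). Proof. exact: (proj2 (lL2 c)). Qed.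

(* On the event [Psi < c ^ 2] every random term of the expansion of the excess
   is small, so that a single Markov inequality suffices. *)
Let Psi w := (rho ^+ 2)^-1 * (bform 1%:M (b + D *m b) (noise M w) ^+ 2 +
    (qform (offdiag blk (A + D *m A)) (noise M w) ^+ 2 +
    ((qform B2d (noise M w) - \tr (B2d *m S)) ^+ 2 +
    (qform (offdiag blk B2) (noise M w) ^+ 2 + bform 1%:M (A^T *m b) (noise M w) ^+ 2))))
  + rho^-1 * (qform Dmaj (noise M w) + qform (D^T *m D) (noise M w)).

Let cS x : qform S x <= xi M * sqnorm x.
Proof.
have := loewner_cov_le (ltW s0) Ss Wl x.
by rewrite /qform bformZ -/(qform _ _) -/(qform _ _) -sqnormE.
Qed.

(** The constant 4 comes from |x + D x|^2 <= 2 |x|^2 + 2 |D x|^2 together with |D x| <= |x|; the 8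
    of [Ex_off] is twice the same 4. *)
Let Ex_lin tm : 0 <= tm -> (forall i, tau i <= tm) -> l * kap * tm ^+ 2 <= 1 ->
  qform S (b + D *m b) <= 4 * xi M * sqnorm b.
Proof.
move=> tm0 htm d1; apply: le_trans (cS _) _.
have h := D_le b tm0 htm.
have : sqnorm (b + D *m b) <= 2 * sqnorm b + 2 * sqnorm (D *m b).
  have := sqnorm_ge0 (b - D *m b).
  rewrite !sqnormE /qform bformBl !bformBr bformDl !bformDr; lra.
move=> h2; rewrite (_ : 4 * xi M * sqnorm b = xi M * (4 * sqnorm b)); last by ring.
apply: ler_wpM2l; first exact/ltW/xi_gt0.
have := ler_wpM2r (sqnorm_ge0 b) d1; lra.
Qed.

Let Ex_off tm : 0 <= tm -> (forall i, tau i <= tm) -> l * kap * tm ^+ 2 <= 1 ->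
  2 * \tr ((A + D *m A) *m S *m (A + D *m A)^T *m S) <= 8 * xi M * t.
Proof.
move=> tm0 htm d1.
have h1 := mxtrace_quad_le pS (ltW s0) Ss Wl (A + D *m A); rewrite -xiE in h1.
suff h2 : \tr ((A + D *m A) *m S *m (A + D *m A)^T) <= 4 * t.
  have := ler_wpM2l (ltW xi_gt0) h2; lra.
pose C : 'M[R]_N := 1%:M + D.
have -> : A + D *m A = C *m A by rewrite mulmxDl mul1mx.
have -> : \tr (C *m A *m S *m (C *m A)^T) = \tr (A *m S *m A^T *m (C^T *m C)).
  by rewrite trmx_mul !mulmxA [RHS]mxtrace_mulC !mulmxA.
have -> : 4 * t = \tr (A *m S *m A^T *m (4 *: 1%:M)).
  by rewrite -scalemxAr mulmx1 mxtraceZ.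
apply: loewner_mxtraceM; first exact: psd_cov_congr.
move=> x; rewrite -sqnormM /C mulmxDl mul1mx /qform bformZ -/(qform _ _) -sqnormE.
have h := D_le x tm0 htm.
have h2 : sqnorm (x + D *m x) <= 2 * sqnorm x + 2 * sqnorm (D *m x).
  have := sqnorm_ge0 (x - D *m x).
  rewrite !sqnormE /qform bformBl !bformBr bformDl !bformDr; lra.
have := ler_wpM2r (sqnorm_ge0 x) d1; lra.
Qed.

(** In each squared block trace one factor is at most [xi tr(C_ii) <= xi], and the other factors sum
    to [t]. *)
Let Ex_v7 : (forall i, \tr (hat_sym2_block M i) <= 1) ->
  K * \sum_i \tr (blkmask blk i *m B2 *m blkmask blk i *m S) ^+ 2 <= K * xi M * t.
Proof.
move=> hc; rewrite -mulrA; apply: ler_wpM2l; first exact: ltW.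
rewrite -trB2d mulr_sumr; apply: ler_sum => i _.
have T0 : 0 <= \tr (blkmask blk i *m B2 *m blkmask blk i *m S).
  apply: mxtraceM_ge0 => //; rewrite -{1}(blkmask_tr blk i); apply: psd_congr; exact: psd_gram.
rewrite expr2; apply: ler_wpM2r => //.
have := mxtrace_block_gram pW pH AE Ps PP PW (ltW s0) (ltW l0) Ss Wl i.
rewrite -mxtrace_hat_sym2_block -xiE => h; apply: le_trans h _.
by apply: ler_piMr; [exact/ltW/xi_gt0|exact: hc].
Qed.

Let Ex_v8 : 2 * \tr (B2 *m S *m B2^T *m S) <= 2 * xi M * t.
Proof.
have h := mxtrace_fit_le pW pS pH AE Hle (ltW s0) Ss Wl.
by rewrite -xiE in h; rewrite -mulrA ler_pM2l.
Qed.

Let Ex_v9 : qform S (A^T *m b) <= xi M * sqnorm b.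
Proof.
rewrite qform_congr trmxK; have := loewner_fit_cov pW pH AE Hle (ltW s0) Ss Wl b.
by rewrite /qform bformZ -/(qform _ _) -/(qform _ _) -sqnormE.
Qed.

Let Ex_Psi tm : 0 < rho -> 0 <= tm -> (forall i, tau i <= tm) -> l * kap * tm ^+ 2 <= 1 ->
  (forall i, \tr (hat_sym2_block M i) <= 1) ->
  L1 P Psi /\ Ex P Psi <= ((10 + K) * xi M + 2 * (xi M * (n%:R * tm ^+ 2))) / rho.
Proof.
move=> r0 tm0 htm d1 hc.
have [LPsi EPsi] := Ex_weighted_sum (rho ^+ 2)^-1 rho^-1 (L1ls (b + D *m b))
  (L1qs (offdiag blk (A + D *m A))) (L1qq B2d (\tr (B2d *m S))) (L1qs (offdiag blk B2))
  (L1ls (A^T *m b)) (L1q Dmaj) (L1q (D^T *m D)).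
split; first exact: LPsi.
rewrite /Psi EPsi.
rewrite (lEx (b + D *m b)) (lEx (A^T *m b)).
rewrite (qEx Dmaj) (qEx (D^T *m D)).
clear EPsi LPsi.
have h1 := Ex_lin tm0 htm d1.
have h2 := le_trans (oEx _) (Ex_off tm0 htm d1).
have h3 := le_trans dEx (Ex_v7 hc).
have h4 := le_trans (oEx _) Ex_v8.
have h5 := Ex_v9.
have hs := ler_wpM2l (ltW xi_gt0) (sum_tau tm0 htm).
have h6 : \tr (Dmaj *m S) <= xi M * (n%:R * tm ^+ 2).
  apply: le_trans hs.
  exact: (mxtrace_blockdiag_hat_majorant pW pH AE Ps PP P0 PW (ltW s0) (ltW l0) Ss Wl l0).
have h7 : \tr (D^T *m D *m S) <= xi M * (n%:R * tm ^+ 2).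
  apply: le_trans hs; rewrite -mulmxA mxtrace_mulC.
  exact: (mxtrace_blockdiag_hat_cov pW pH AE Ps PP P0 PW (ltW s0) (ltW l0) Ss Wl).
(* The squares have weight [1 / rho^2] and total mean at most [(10 + K) xi rho]; the two forms of
   weight [1 / rho] have mean at most [xi n tm^2] each. *)
rewrite mulrDl; apply: lerD; last first.
  by rewrite mulrC ler_pM2r ?invr_gt0//; lra.
rewrite [X in _ <= X / _](_ : _ = (10 + K) * xi M * rho / rho); last first.
  by rewrite mulfK// gt_eqF.
rewrite [X in _ <= X](_ : _ = (rho ^+ 2)^-1 * ((10 + K) * xi M * rho)); last first.
  by field; rewrite gt_eqF.
rewrite ler_pM2l ?invr_gt0 ?exprn_gt0//.
exact: moment_sum_bound K0 xi_gt0 (sqnorm_ge0 b) fit_var_ge0 h1 h2 h3 h4 h5.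
Qed.

Let measurable_vec (f : sample M -> 'cV[R]_N) := forall a, measurable_fun setT (fun w => f w a 0).

Let noise_meas : measurable_vec (noise M).
Proof. by move=> a; exact: err_measurable. Qed.

Let measM (C : 'M[R]_N) f : measurable_vec f -> measurable_vec (fun w => C *m f w).
Proof.
move=> mf a; under eq_fun do rewrite mxE.
by apply: measurable_sum => c; apply: measurable_funM.
Qed.

Let meas_r : measurable_vec r.
Proof.
move=> a; rewrite (_ : (fun w => r w a 0) = fun w => (A *m noise M w) a 0 - b a 0).
  by apply: measurable_funB => //; exact: measM.
by apply/funext => w; rewrite /r mxE [X in _ + X]mxE.
Qed.

Let meas_bform (C : 'M[R]_N) f g : measurable_vec f -> measurable_vec g ->
  measurable_fun setT (fun w => bform C (f w) (g w)).
Proof.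
move=> mf mg; rewrite (_ : (fun w => _) = fun w => \sum_c (\sum_a f w a 0 * C a c) * g w c 0).
  apply: measurable_sum => c; apply: measurable_funM => //.
  by apply: measurable_sum => a; apply: measurable_funM.
apply/funext => w; rewrite /bform mxE; apply: eq_bigr => c _; congr (_ * _).
by rewrite mxE; apply: eq_bigr => a _; rewrite mxE.
Qed.

Let excess w := LsoCV M w - loss M w - n%:R^-1 * sqnorm (noise M w).

Let excessE w : excess w = 2 / n%:R * (bform 1%:M (b + D *m b) (noise M w)
  - qform (offdiag blk (A + D *m A)) (noise M w)
  - qform (D *m D) (noise M w) - bform 1%:M (D *m noise M w) (r w) + qform D (r w)).
Proof.
rewrite -criterionE -/(excess w); have : n%:R != 0 :> R by rewrite gt_eqF.
by move: (excess w) => x ?; field.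
Qed.

Let meas_excess : measurable_fun setT excess.
Proof.
rewrite (_ : excess = fun w => 2 / n%:R * (bform 1%:M (b + D *m b) (noise M w)
  - qform (offdiag blk (A + D *m A)) (noise M w)
  - qform (D *m D) (noise M w) - bform 1%:M (D *m noise M w) (r w) + qform D (r w))).
  apply: measurable_funM => //; apply: measurable_funD; last exact: meas_bform.
  apply: measurable_funB; last by apply: meas_bform => //; exact: measM.
  apply: measurable_funB; last exact: meas_bform.
  apply: measurable_funB; last exact: meas_bform.
  by apply: meas_bform => // a; exact: measurable_cst.
by apply/funext => w; rewrite excessE.
Qed.

Let meas_loss : measurable_fun setT (loss M).
Proof.
rewrite (_ : loss M = fun w => n%:R^-1 * bform 1%:M (r w) (r w)).
  by apply: measurable_funM => //; exact: meas_bform.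
by apply/funext => w; rewrite lossE sqnormE.
Qed.

(** The excess is [2 / n] times the expansion and the loss is |r|^2 / n, so the 9 of
    [criterion_bound] becomes 18. *)
Let pointwise c tm w : 0 < rho -> 0 < c -> c <= 8^-1 -> 0 <= tm -> (forall i, tau i <= tm) ->
  l * kap * tm ^+ 2 <= 2 * c ^+ 2 -> Psi w < c ^+ 2 ->
  `|excess w| <= 18 * c * `|loss M w|.
Proof.
move=> r0 c0 c8 tm0 htm d2 psi.
have L0 := sqnorm_ge0 (r w).
(* The loss is its mean plus three centred fluctuations: the diagonal blocks of [A^T A] have mean
   [t], while the off-diagonal form and the linear term have mean zero. *)
have rl : sqnorm (r w) = rho + (qform B2d (noise M w) - \tr (B2d *m S))
    + qform (offdiag blk B2) (noise M w) - 2 * bform 1%:M (A^T *m b) (noise M w).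
  rewrite /r sqnorm_loss_identity trB2dS /rho /tot_risk -/t -/b.
  have -> : qform (A^T *m A) (noise M w) = qform B2d (noise M w) + qform (offdiag blk B2) (noise M w).
    by rewrite offdiagE /qform -bformD addrC subrK.
  by ring.
have maj := qform_blockdiag_hat2 pW pH AE Ps PW (noise M w) l0.
have maj0 := le_trans (normr_ge0 _) maj.
have deE : qform (D^T *m D) (noise M w) = sqnorm (D *m noise M w) by rewrite sqnormM.
have de0 : 0 <= qform (D^T *m D) (noise M w) by rewrite deE; exact: sqnorm_ge0.
have hx := bform1_amgm (D *m noise M w) (r w) c0; rewrite -deE in hx.
have hq := bform1_amgm (D *m r w) (r w) c0.
have qE : bform 1%:M (D *m r w) (r w) = qform D (r w).
  by rewrite bformC trmx1 /qform /bform mulmx1 mulmxA.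
rewrite qE in hq.
have hdr : sqnorm (D *m r w) <= 2 * c ^+ 2 * sqnorm (r w).
  by apply: le_trans (D_le _ tm0 htm) _; apply: ler_wpM2r.
have h := criterion_bound r0 c0 c8 maj0 de0 L0 psi rl maj hx hq hdr erefl.
rewrite excessE lossE !normrM [`|sqnorm _|]ger0_norm// [`|n%:R^-1|]ger0_norm ?invr_ge0 ?(ltW nR0)//.
rewrite [`|2|]ger0_norm//.
have -> : 18 * c * (n%:R^-1 * sqnorm (r w)) = 2 * n%:R^-1 * (9 * c * sqnorm (r w)) by ring.
by apply: ler_wpM2l => //; rewrite mulr_ge0// invr_ge0 ltW.
Qed.

Lemma measurable_excess_set eps :
  measurable [set w | eps * `|loss M w| < `|LsoCV M w - loss M w - n%:R^-1 * sqnorm (noise M w)|].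
Proof.
apply: measurable_lt_set.
  by apply: measurable_funM => //; apply: measurableT_comp => //; exact: meas_loss.
by apply: measurableT_comp => //; exact: meas_excess.
Qed.

Lemma prob_excess_le eps c tm : 18 * c <= eps -> 0 < rho -> 0 < c -> c <= 8^-1 -> 0 <= tm ->
  (forall i, \tr (hat_block M i) <= tm) -> (forall i, \tr (hat_sym2_block M i) <= 1) ->
  lambda_max (wcor M) * lambda_max (invmx (wcor M)) * tm ^+ 2 <= 2 * c ^+ 2 ->
  (P [set w | (eps * `|loss M w| < `|(LsoCV M w - loss M w - n%:R^-1 * sqnorm (noise M w))|)%R]
    <= (((10 + K) * xi M + 2 * (xi M * (n%:R * tm ^+ 2))) / rho / c ^+ 2)%:E)%E.
Proof.
move=> ce r0 c0 c8 tm0 htm hc d2.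
have d1 : l * kap * tm ^+ 2 <= 1.
  apply: le_trans d2 _; have : c ^+ 2 <= 8^-1 ^+ 2 by rewrite lerXn2r ?nnegrE// ltW.
  by rewrite expr2; lra.
have [LPsi EPsi] := Ex_Psi r0 tm0 htm d1 hc.
have c2 : 0 < c ^+ 2 by rewrite exprn_gt0.
have mPsi := L1_measurable LPsi.
have Psi0 w : 0 <= Psi w.
  have maj0 := le_trans (normr_ge0 _) (qform_blockdiag_hat2 pW pH AE Ps PW (noise M w) l0).
  have de0 : 0 <= qform (D^T *m D) (noise M w) by rewrite -sqnormM; exact: sqnorm_ge0.
  rewrite /Psi addr_ge0//; apply: mulr_ge0.
  - by rewrite invr_ge0 exprn_ge0// ltW.
  - by rewrite !addr_ge0 ?sqr_ge0.
  - by rewrite invr_ge0 ltW.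
  - exact: addr_ge0.
apply: (@le_trans _ _ (P [set w | (c ^+ 2 <= Psi w)%R])).
  apply: le_measure; rewrite ?inE /=.
  - exact: measurable_excess_set.
  - by apply: measurable_le_set => //; exact: measurable_cst.
  - move=> w /= hw; rewrite leNgt; apply/negP => hP.
    have := le_trans (pointwise r0 c0 c8 tm0 htm d2 hP) (ler_wpM2r (normr_ge0 _) ce).
    by rewrite leNgt hw.
apply: le_trans (Ex_markov mPsi c2 LPsi Psi0) _.
by rewrite lee_fin ler_pM2r// invr_gt0.
Qed.

End Criterion.

(** * Passage to the limit *)

Unset Implicit Arguments.

(* [t] stands for [tr (A^T A Sigma)]: when it vanishes the ratio of Condition 4
   is the junk value 0, hence the separate hypothesis [t = 0 -> trA = 0]. *)
Lemma tail_bound_arith (R : realType) (n K xi rho t tm trA C c d : R) :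
  0 < n -> 0 < K -> 0 < xi -> 0 < rho -> 0 < c -> 0 < d -> 0 <= t -> t <= rho ->
  0 <= tm -> tm <= C * `|trA / n| -> 0 < C -> (t = 0 -> trA = 0) ->
  `|xi / n| <= d * c ^+ 2 / (2 * (10 + K)) * (rho / n) ->
  `|xi * (n^-1 * trA) ^+ 2 / (n^-1 * t)| <= d * c ^+ 2 / (4 * C ^+ 2) ->
  ((10 + K) * xi + 2 * (xi * (n * tm ^+ 2))) / rho / c ^+ 2 <= d.
Proof.
move=> n0 K0 x0 r0 c0 d0 t0 tr tm0 tmC C0 tz h3 h4.
have c2 : 0 < c ^+ 2 by rewrite exprn_gt0.
have K10 : 0 < 10 + K by lra.
rewrite ler_pdivrMr// ler_pdivrMr//.
(* The two summands are each given half of the budget [d c^2 rho]: Condition 3 pays for the first,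
   Condition 4 for the second, which appears with a factor 2. *)
have a1 : (10 + K) * xi <= d * c ^+ 2 * rho / 2.
  move: h3; rewrite ger0_norm ?divr_ge0 ?(ltW x0) ?(ltW n0)// mulrA ler_pM2r ?invr_gt0// => h3.
  have := ler_wpM2l (ltW K10) h3.
  have -> : (10 + K) * (d * c ^+ 2 / (2 * (10 + K)) * rho) = d * c ^+ 2 * rho / 2.
    by field; rewrite gt_eqF.
  by [].
have a2 : xi * (n * tm ^+ 2) <= d * c ^+ 2 * rho / 4.
  have h : tm ^+ 2 <= C ^+ 2 * (trA / n) ^+ 2.
    by rewrite -[(trA / n) ^+ 2]real_normK ?num_real// -exprMn lerXn2r ?nnegrE// (le_trans tm0).
  have [tz0|tnz] := eqVneq t 0.
    have -> : tm = 0.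
      apply/eqP; rewrite eq_le tm0 andbT; apply: le_trans tmC _.
      by rewrite tz// mul0r normr0 mulr0.
    by rewrite expr0n /= !mulr0 divr_ge0// !mulr_ge0// ltW.
  have tp : 0 < t by rewrite lt_neqAle eq_sym tnz.
  have q0 : 0 <= xi * (n^-1 * trA) ^+ 2 / (n^-1 * t).
    apply: divr_ge0; apply: mulr_ge0; [exact: ltW|exact: sqr_ge0|by rewrite invr_ge0 ltW|exact: t0].
  move: h4; rewrite ger0_norm// ler_pdivrMr ?mulr_gt0 ?invr_gt0// => h4.
  have xn : 0 < xi * n by rewrite mulr_gt0.
  have := ler_wpM2l (ltW xn) h.
  have -> : xi * n * (C ^+ 2 * (trA / n) ^+ 2) = C ^+ 2 * n * (xi * (n^-1 * trA) ^+ 2).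
    by rewrite [trA / n]mulrC; ring.
  have cn : 0 < C ^+ 2 * n by rewrite mulr_gt0// exprn_gt0.
  have := ler_wpM2l (ltW cn) h4.
  have -> : C ^+ 2 * n * (d * c ^+ 2 / (4 * C ^+ 2) * (n^-1 * t)) = d * c ^+ 2 * t / 4.
    by field; rewrite !gt_eqF.
  have : d * c ^+ 2 * t <= d * c ^+ 2 * rho by rewrite ler_pM2l// mulr_gt0.
  rewrite -mulrA; lra.
by lra.
Qed.

Theorem theorem3p1 (R : realType) (M : forall n : nat, model R n)
    (C1 : condition1 M) (C2 : condition2 M) (C3 : condition3 M)
    (C4 : condition4 M) (C5 : condition5 M) :
  littleo_p M
    (fun n w => LsoCV (M n) w - loss (M n) w
                - n%:R^-1 * sqnorm (noise (M n) w))
    (fun n w => loss (M n) w).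
Proof.
have [K K0 c1] := C1; have [/eqO_exP[C C0 hO] _ h2] := C2.
(* The bound 1/8 is what [criterion_bound] requires, and [eps / 18] makes the pointwise factor
   [18 c] at most [eps]. *)
move=> eps eps0; pose c := Num.min (8^-1) (eps / 18).
have c0 : 0 < c by rewrite lt_min; apply/andP; split; rewrite ?invr_gt0// divr_gt0.
have c8 : c <= 8^-1 by rewrite ge_min lexx.
have ce : 18 * c <= eps by rewrite -ler_pdivlMl// mulrC ge_min lexx orbT.
(* The largest block trace is at most [C tr(A) / n], so this threshold in Condition 5 yields [2 c^2]
   for that trace. *)
have cC : 0 < 2 * c ^+ 2 / C ^+ 2 by rewrite divr_gt0 ?mulr_gt0 ?exprn_gt0.
apply/fine_cvgP; split.
  near=> n; rewrite fin_num_measure//; apply: measurable_excess_set.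
  by near: n; exact: nbhs_infty_gt.
apply/cvgrPdist_le => d d0.
have K10 : 0 < 10 + K by lra.
have d3 : 0 < d * c ^+ 2 / (2 * (10 + K)) by rewrite divr_gt0 ?mulr_gt0 ?exprn_gt0.
have d4 : 0 < d * c ^+ 2 / (4 * C ^+ 2) by rewrite divr_gt0 ?mulr_gt0 ?exprn_gt0.
have /eqoP /(_ _ d3) h3 := C3.
have /cvgrPdist_le /(_ _ d4) h4 := C4.
have /cvgrPdist_le /(_ _ cC) h5 := C5.
have /cvgrPdist_le /(_ _ ltr01) h2' := h2.
near=> n.
have n0 : (0 < n)%N by near: n; exact: nbhs_infty_gt.
have nR : 0 < n%:R :> R by rewrite ltr0n.
have g3 : `|xi (M n) / n%:R| <= d * c ^+ 2 / (2 * (10 + K)) * `|risk (M n)| by near: n.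
have g4 : `|0 - xi (M n) * (n%:R^-1 * \tr (hat (M n))) ^+ 2
    / (n%:R^-1 * \tr ((hat (M n))^T *m hat (M n) *m Sigma (M n)))| <= d * c ^+ 2 / (4 * C ^+ 2).
  by near: n.
have g5 : `|0 - lambda_max (wcor (M n)) * lambda_max (invmx (wcor (M n)))
    * (n%:R ^- 2 * \tr (hat (M n)) ^+ 2)| <= 2 * c ^+ 2 / C ^+ 2 by near: n.
have g2 : `|0 - \big[Num.max/0]_(i < n) \tr (hat_sym2_block (M n) i)| <= 1 by near: n.
have gO : `|\big[Num.max/0]_(i < n) \tr (hat_block (M n) i)| <= C * `|\tr (hat (M n)) / n%:R|.
  by near: n.
set tm := \big[Num.max/0]_(i < n) \tr (hat_block (M n) i) in gO.
have tm0 : 0 <= tm by exact: bigmax_ge_id.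
have htm i : \tr (hat_block (M n) i) <= tm by exact: le_bigmax.
have hc i : \tr (hat_sym2_block (M n) i) <= 1.
  move: g2; rewrite sub0r normrN ger0_norm; last exact: bigmax_ge_id.
  by apply: le_trans; exact: le_bigmax.
have x0 := xi_gt0 (M n) n0.
have rE := riskE n0 K0 (c1 n).
have t0 := fit_var_ge0 (M n).
have b0 := sqnorm_ge0 (bias (M n)).
have rho0 : 0 <= tot_risk (M n) by rewrite addr_ge0.
have risk0 : 0 <= risk (M n) by rewrite -(pmulr_rge0 _ nR) rE.
have riskE' : risk (M n) = tot_risk (M n) / n%:R.
  by rewrite -rE mulrAC divff ?mul1r// gt_eqF.
(* A vanishing risk would force xi to vanish by Condition 3, whereas xi is positive. *)
have rho1 : 0 < tot_risk (M n).
  rewrite lt_neqAle rho0 andbT eq_sym; apply: contraTneq x0 => r00.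
  move: g3; rewrite riskE' r00 mul0r normr0 mulr0 normr_le0 mulf_eq0 invr_eq0.
  by rewrite [_ == 0 :> R in X in _ || X]gt_eqF// orbF => /eqP ->; rewrite ltxx.
have g5' : lambda_max (wcor (M n)) * lambda_max (invmx (wcor (M n))) * tm ^+ 2 <= 2 * c ^+ 2.
  move: g5; rewrite sub0r normrN => /(le_trans (ler_norm _)) g5.
  have lk0 : 0 < lambda_max (wcor (M n)) * lambda_max (invmx (wcor (M n))) by exact: wcor_cond_gt0.
  have h : tm ^+ 2 <= C ^+ 2 * (\tr (hat (M n)) / n%:R) ^+ 2.
    move: gO; rewrite ger0_norm// => gO.
    rewrite -[(_ / _) ^+ 2]real_normK ?num_real// -exprMn lerXn2r ?nnegrE//.
    by rewrite mulr_ge0// ltW.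
  apply: le_trans (ler_wpM2l (ltW lk0) h) _.
  move: g5; rewrite ler_pdivlMr ?exprn_gt0//; apply: le_trans.
  rewrite le_eqVlt; apply/orP; left; apply/eqP; rewrite exprMn exprVn; ring.
have := prob_excess_le n0 K0 (c1 n) ce rho1 c0 c8 tm0 htm hc g5'.
set Pn := prob (M n) _ => hP.
rewrite sub0r normrN ger0_norm; last by rewrite fine_ge0.
rewrite -lee_fin fineK; last by rewrite fin_num_measure//; exact: measurable_excess_set.
apply: le_trans hP _; rewrite lee_fin.
apply: (@tail_bound_arith _ _ _ _ _ (fit_var (M n)) _ (\tr (hat (M n))) C) => //.
- by rewrite lerDr.
- by move: gO; rewrite ger0_norm.
- by move=> /fit_var0_hat0 ->; rewrite mxtrace0.
- by move: g3; rewrite [`|risk _|]ger0_norm// riskE'.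
(* The denominator of Condition 4 is [fit_var] up to a cyclic permutation under the trace. *)
- move: g4; rewrite sub0r normrN.
  by rewrite -[_ *m _ *m Sigma _]mulmxA [\tr (_ *m (_ *m Sigma _))]mxtrace_mulC.
Unshelve. all: by end_near.
Qed.
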